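(* Let $\alpha\in(0,1/2)$ and $r\in(0,1]$, and write $f=f_\alpha$, $f_k=f_{\alpha,k}$. For all $x\in[0,1]$ and $1\le\ell\le\infty$, the limits $$\mathrm{c}_\ell^f(x,r)=\lim_{n\to\infty}\mathrm{C}_\ell^f(x,n,r),\qquad \mathrm{det}_\ell^f(x,r)=\lim_{n\to\infty}\mathrm{DET}_\ell^f(x,n,r)$$ exist. Moreover: - $\mathrm{c}_\ell^f(x,r)=\mathrm{c}_\ell^f(r)$ and $\mathrm{det}_\ell^f(x,r)=\mathrm{det}_\ell^f(r)$ for all $x$ that are not eventually periodic for $f$; - $\mathrm{c}_\ell^f(x,r)=\mathrm{c}_\ell^{f_k}(r)$ and $\mathrm{det}_\ell^f(x,r)=\mathrm{det}_\ell^{f_k}(r)$ for every $x$ that is eventually periodic for $f$ of period $2^k$, where $k\ge0$.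
   Context: For $\alpha\in(0,1/2)$ the continuous map $f_\alpha:[0,1]\to[0,1]$ is defined by: $f_\alpha(x)=x-1+2\alpha^{j-1}-\alpha^j$ for $x\in[1-\alpha^{j-1},1-\alpha^{j-1}+\alpha^j]$, $j\ge1$; $f_\alpha(x)=\frac{1-\alpha+\alpha^2}{2\alpha-1}(x-1)+\alpha^{j+1}\frac{2-\alpha}{2\alpha-1}$ for $x\in(1-\alpha^{j-1}+\alpha^j,1-\alpha^j)$, $j\ge1$; and $f_\alpha(1)=0$. For $k\ge1$, $f_{\alpha,k}:[0,1]\to[0,1]$ is the continuous map equal to $f_\alpha$ on $[0,1-\alpha^{k-1}+\alpha^k]$, equal to $x-1+\alpha^k$ on $[1-\alpha^k,1]$, and linear in between; $f_{\alpha,0}$ is the identity. A point $x$ is eventually periodic for $f$ if there are $i\ge0$ and $p>0$ with $f^{mp}(f^i(x))=f^i(x)$ for every $m\ge0$; the smallest such $p$ is its period. All periods of $f_\alpha$ are of the form $2^k$, $k\ge0$. For a word $u=u_1\dots u_k\in\{0,1\}^k$ put $\kappa(u)=(1-\alpha)\sum_{i=1}^k u_i\alpha^{i-1}$ and $I_\alpha(u)=[\kappa(u),\kappa(u)+\alpha^k]$. The measure $\mu_\alpha$ is the unique Borel probability measure on $[0,1]$ with $\mu_\alpha(I_\alpha(u))=2^{-k}$ for all $k\ge1$, $u\in\{0,1\}^k$. The measure $\mu_{\alpha,k}$ is the uniform probability measure on the $f_{\alpha,k}$-orbit of $0$ (a periodic orbit with $2^k$ points, namely $\{\kappa(u):u\in\{0,1\}^k\}$).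 For a map $g:[0,1]\to[0,1]$ and $1\le\ell\le\infty$ put $\varrho_\ell^g(x,y)=\sup\{|g^i(x)-g^i(y)|:0\le i<\ell\}$. Correlation sum: $\mathrm{C}_\ell^g(x,n,r)=\frac1{n^2}\#\{(i,j):0\le i,j<n,\ \varrho_\ell^g(g^i(x),g^j(x))\le r\}$. Recurrence rate: $\mathrm{RR}_\ell^g(x,n,r)$ is $\frac1{n^2}$ times the number of pairs $(i,j)$, $0\le i,j<n$, for which there is $0\le k\le\min\{i,j,\ell-1\}$ (with $\min\{i,j,\infty-1\}=\min\{i,j\}$) with $\varrho_\ell^g(g^{i-k}(x),g^{j-k}(x))\le r$. Determinism: $\mathrm{DET}_\ell^g=\mathrm{RR}_\ell^g/\mathrm{RR}_1^g$. For $g=f_\alpha$ with $\nu=\mu_\alpha$, or $g=f_{\alpha,k}$ with $\nu=\mu_{\alpha,k}$: $\mathrm{c}_\ell^g(r)=\nu\times\nu\{(x,y):\varrho_\ell^g(x,y)\le r\}$, $\mathrm{det}_\ell^g(r)=\frac{\ell\,\mathrm{c}_\ell^g(r)-(\ell-1)\mathrm{c}_{\ell+1}^g(r)}{\mathrm{c}_1^g(r)}$ for $\ell<\infty$, and $\mathrm{det}_\infty^g(r)=\mathrm{c}_\infty^g(r)/\mathrm{c}_1^g(r)$. *)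

(* Defs.v *)
From HB Require Import structures.
From mathcomp Require Import all_boot all_order all_algebra finmap.
From mathcomp Require Import all_classical all_reals all_analysis.
From mathcomp Require Import ring lra.

Set Implicit Arguments.
Unset Strict Implicit.
Unset Printing Implicit Defensive.

Import Order.TTheory GRing.Theory Num.Theory.
Import numFieldNormedType.Exports.

Local Open Scope classical_set_scope.
Local Open Scope ring_scope.

(* Self-maps of [0, 1] are functions R -> R; every notion below evaluates them
   only at points of [0, 1], which the maps of interest leave invariant. *)

Section maps.
Context {R : realType}.
Implicit Types (alpha x : R) (j k : nat).

(* For 0 < alpha < 1/2 and 0 <= x < 1 exactly one j satisfies the condition. *)
Definition level alpha x : nat :=
  xget 1%N [set j | (1 <= j)%N /\ 1 - alpha ^+ j.-1 <= x < 1 - alpha ^+ j].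

Definition falpha alpha x : R :=
  if x == 1 then 0 else
  let j := level alpha x in
  if x <= 1 - alpha ^+ j.-1 + alpha ^+ j
  then x - 1 + 2 * alpha ^+ j.-1 - alpha ^+ j
  else (1 - alpha + alpha ^+ 2) / (2 * alpha - 1) * (x - 1)
       + alpha ^+ j.+1 * ((2 - alpha) / (2 * alpha - 1)).

Definition falphak alpha k x : R :=
  if k is 0%N then x else
  let a := 1 - alpha ^+ k.-1 + alpha ^+ k in
  let b := 1 - alpha ^+ k in
  let ya := falpha alpha a in
  let yb := b - 1 + alpha ^+ k in
  if x <= a then falpha alpha x
  else if b <= x then x - 1 + alpha ^+ k
  else ya + (yb - ya) * ((x - a) / (b - a)).

Lemma level_eq alpha x j : 0 < alpha < 2^-1 -> (1 <= j)%N ->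
  1 - alpha ^+ j.-1 <= x < 1 - alpha ^+ j -> level alpha x = j.
Proof.
move=> /andP[a0 a2] j1 /andP[xl xr]; apply: xget_unique.
  by split=> //; apply/andP.
have a1 : alpha <= 1 by lra.
have mono m n : (m < n)%N -> alpha ^+ n.-1 <= alpha ^+ m.
  by case: n => // n; rewrite ltnS /= => mn; apply: ler_wiXn2l => //; apply: ltW.
move=> i [i1 /andP[yl yr]]; case: (ltngtP i j) => // /mono h; exfalso; lra.
Qed.

Lemma falpha_left alpha x j : 0 < alpha < 2^-1 -> (1 <= j)%N ->
  1 - alpha ^+ j.-1 <= x <= 1 - alpha ^+ j.-1 + alpha ^+ j ->
  falpha alpha x = x - 1 + 2 * alpha ^+ j.-1 - alpha ^+ j.
Proof.
move=> ha; case: j => // j _ /=; rewrite exprS => /andP[xl xr].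
have /andP[a0 a2] := ha.
have p0 : 0 < alpha ^+ j by apply: exprn_gt0.
have pa : alpha * alpha ^+ j < 2^-1 * alpha ^+ j by rewrite ltr_pM2r.
rewrite /falpha (@level_eq alpha x j.+1)//=; last by rewrite exprS; lra.
by rewrite exprS xr ifF//; apply/negbTE/eqP; lra.
Qed.

Lemma falpha_right alpha x j : 0 < alpha < 2^-1 -> (1 <= j)%N ->
  1 - alpha ^+ j.-1 + alpha ^+ j < x < 1 - alpha ^+ j ->
  falpha alpha x = (1 - alpha + alpha ^+ 2) / (2 * alpha - 1) * (x - 1)
                   + alpha ^+ j.+1 * ((2 - alpha) / (2 * alpha - 1)).
Proof.
move=> ha j1 /andP[xl xr]; have /andP[a0 a2] := ha.
have p0 : 0 < alpha ^+ j by apply: exprn_gt0.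
rewrite /falpha (@level_eq alpha x j)//=; last by apply/andP; split => //; lra.
by rewrite leNgt xl /= ifF//; apply/negbTE/eqP; lra.
Qed.

End maps.

Section dynamics.
Context {R : realType}.
Implicit Types (g : R -> R) (x : R) (p : nat).

Definition orbit g x : set R := range (fun i => iter i g x).

Definition eventual_period g x p : Prop :=
  (0 < p)%N /\
  exists i, forall m, iter (m * p)%N g (iter i g x) = iter i g x.

Definition eventually_periodic g x : Prop := exists p, eventual_period g x p.

Definition eventually_periodic_of_period g x p : Prop :=
  eventual_period g x p /\ forall q, eventual_period g x q -> (p <= q)%N.

End dynamics.

Section recurrence.
Context {R : realType}.
(* The parameter 1 <= ell <= oo: Some l is the finite value l, None is oo. *)
Implicit Types (ell : option nat) (g : R -> R) (x y r : R) (n : nat).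

Definition ell_ge1 ell : bool := if ell is Some l then (1 <= l)%N else true.

Definition lt_ell (i : nat) ell : bool :=
  if ell is Some l then (i < l)%N else true.

Definition varrho g ell x y : R :=
  sup [set `|iter i g x - iter i g y| | i in [set i | lt_ell i ell]].

Definition corr_sum g ell x n r : R :=
  #|[set ij : 'I_n * 'I_n
      | varrho g ell (iter ij.1 g x) (iter ij.2 g x) <= r]%SET|%:R
  / n%:R ^+ 2.

Definition min_ell (i j : nat) ell : nat :=
  if ell is Some l then minn (minn i j) l.-1 else minn i j.

Definition rec_rate g ell x n r : R :=
  #|[set ij : 'I_n * 'I_n | [exists k : 'I_(min_ell ij.1 ij.2 ell).+1,
      varrho g ell (iter (ij.1 - k) g x) (iter (ij.2 - k) g x) <= r]]%SET|%:R
  / n%:R ^+ 2.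

Definition determinism g ell x n r : R :=
  rec_rate g ell x n r / rec_rate g (Some 1%N) x n r.

Definition corr_lim g ell x r : R := limn (fun n => corr_sum g ell x n r).

Definition det_lim g ell x r : R := limn (fun n => determinism g ell x n r).

End recurrence.

Section measures.
Context {R : realType}.
Local Notation RM := (measurableTypeR R).

Definition kappa (alpha : R) (k : nat) (u : k.-tuple bool) : R :=
  (1 - alpha) * \sum_(i < k) (tnth u i)%:R * alpha ^+ i.

Definition Ialpha (alpha : R) (k : nat) (u : k.-tuple bool) : set R :=
  `[kappa alpha u, kappa alpha u + alpha ^+ k]%classic.

(* A Borel probability measure on [0, 1] is a Borel probability measure on the
   line that gives mass 1 to [0, 1]. *)
Definition is_mu_alpha (alpha : R) (mu : probability RM R) : Prop :=
  mu `[0, 1]%classic = 1%E /\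
  forall (k : nat) (u : k.-tuple bool), (1 <= k)%N ->
    mu (Ialpha alpha u) = (2 ^- k)%:E.

(* The uniform probability measure on O, for O finite and nonempty. *)
Definition uniform_on (O : set R) : {measure set RM -> \bar R} :=
  mscale (#|` fset_set O|%:R^-1)%:nng
    (msum (fun i => \d_((nth 0 (fset_set O) i) : RM)) #|` fset_set O|).

Definition mu_alphak (alpha : R) (k : nat) : {measure set RM -> \bar R} :=
  uniform_on (orbit (falphak alpha k) 0).

Definition corr_int (g : R -> R) (nu : {measure set RM -> \bar R})
    (ell : option nat) (r : R) : R :=
  fine ((nu \x nu)%E
    [set xy | 0 <= xy.1 <= 1 /\ 0 <= xy.2 <= 1 /\ varrho g ell xy.1 xy.2 <= r]).

Definition det_int (g : R -> R) (nu : {measure set RM -> \bar R})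
    (ell : option nat) (r : R) : R :=
  (if ell is Some l
   then l%:R * corr_int g nu ell r - (l%:R - 1) * corr_int g nu (Some l.+1) r
   else corr_int g nu None r)
  / corr_int g nu (Some 1%N) r.

End measures.

(* Main.v *)
(* On words of length k, f_alpha acts as the odometer, and it translates every
   interval I(u) except the one coded by 1...1, where it is a copy of itself
   scaled by alpha^k. Iterating this renormalization, an orbit either lands on a
   translate of the 2^k-periodic orbit of codes, via the repelling fixed point of
   the middle branch, or it is eventually within alpha^k of that orbit for
   every k; these are the eventually periodic and the other points. In the first
   case all distances agree with those of f_{alpha,k}. In the second, both the
   correlation sums and the correlation integral are bracketed by the pair
   densities of the odometer on 2^k codes at the radii r - alpha^k and r + alpha^k.
   The bracket shrinks to a point: distinct codes are more than alpha^k apart, so a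
   distance in this window determines the second code up to boundedly many
   choices; for infinite l, subadditivity of kappa identifies the supremum of the
   distances as max(kappa(a - b), kappa(b - a)). Finally, counting runs along
   diagonals gives RR_l = l C_l - (l - 1) C_{l+1} + O(1/n), and RR_oo = C_oo
   because the distance for l = oo does not increase along orbits. *)
Require Import Defs.
From HB Require Import structures.
From mathcomp Require Import all_boot all_order all_algebra finmap.
From mathcomp Require Import all_classical all_reals all_analysis.
From mathcomp Require Import measurable_realfun.
From mathcomp Require Import ring lra zify.
Import Order.TTheory GRing.Theory Num.Theory.
Import numFieldNormedType.Exports.
Local Open Scope classical_set_scope.
Local Open Scope ring_scope.
Set Implicit Arguments.
Unset Strict Implicit.
Unset Printing Implicit Defensive.

(** * Odometer codes *)

Section kap.
Context {R : realType}.
Implicit Types (al x y z : R) (k n : nat).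

(* [kap al k n] is the paper's kappa(u) for the word u of the k lowest binary
   digits of n, lowest digit first; on these codes f_alpha adds 1 modulo 2^k. *)
Fixpoint kap al k n : R :=
  if k is k'.+1 then (1 - al) * (odd n)%:R + al * kap al k' n./2 else 0.

Lemma kapD al k a b : (a < 2 ^ k)%N ->
  kap al k.+1 (a + b * 2 ^ k) = kap al k a + al ^+ k * (1 - al) * (odd b)%:R.
Proof.
elim: k a => [|k IH] a; first by case: a => //= _; rewrite expn0 muln1 add0n; ring.
move=> ha; rewrite [LHS]/= -/(kap al k.+1 _).
have -> : odd (a + b * 2 ^ k.+1) = odd a.
  by rewrite oddD oddM oddX /= andbF addbF.
have -> : (a + b * 2 ^ k.+1)./2 = (a./2 + b * 2 ^ k)%N.
  by rewrite expnS mulnCA mul2n halfD doubleK odd_double andbF.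
rewrite IH; first by rewrite exprS /=; ring.
by rewrite expnS in ha; lia.
Qed.

Lemma kap_dvd al k n : (2 ^ k %| n)%N -> kap al k n = 0.
Proof.
elim: k n => //= k IH n /dvdnP[q ->].
rewrite expnS mulnCA mul2n odd_double doubleK IH ?dvdn_mull//.
by rewrite mulr0 mulr0 addr0.
Qed.

Lemma kap_modD al k a b : kap al k (a + b * 2 ^ k) = kap al k a.
Proof.
elim: k a => [//|k IH] a /=.
rewrite oddD oddM oddX /= andbF addbF.
by rewrite expnS mulnCA mul2n halfD doubleK odd_double andbF IH.
Qed.

Lemma kap_mod al k a b : a = b %[mod 2 ^ k] -> kap al k a = kap al k b.
Proof.
move=> h; rewrite (divn_eq a (2 ^ k)) (divn_eq b (2 ^ k)) h addnC kap_modD.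
by rewrite addnC kap_modD.
Qed.

(** The residue -1 is the word of all ones, whose digits add up to a geometric sum. *)
Lemma kap_pred al k n : (2 ^ k %| n.+1)%N -> kap al k n = 1 - al ^+ k.
Proof.
elim: k n => [|k IH] n; first by rewrite /= expr0 subrr.
move=> h; have on : odd n.
  have : (2 %| n.+1)%N by apply: dvdn_trans h; rewrite expnS dvdn_mulr.
  by rewrite dvdn2 /= negbK.
rewrite /= on IH ?exprS; first by rewrite mulr1; ring.
have -> : (n./2.+1 = n.+1./2)%N by lia.
move: h => /dvdnP[q ->]; rewrite expnS mulnCA mul2n doubleK.
exact: dvdn_mull.
Qed.

Section alpha.
Variable al : R.
Hypothesis hal : 0 < al < 2^-1.

Let al0 : 0 < al. Proof. by case/andP: hal. Qed.

Ltac alra := have /andP[? ?] := hal; lra.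

Lemma alX_gt0 k : 0 < al ^+ k. Proof. exact: exprn_gt0. Qed.

Lemma alX_le1 k : al ^+ k <= 1.
Proof. by apply: exprn_ile1; alra. Qed.

Lemma kap_ge0 k n : 0 <= kap al k n.
Proof.
elim: k n => //= k IH n; apply: addr_ge0; apply: mulr_ge0 => //.
- alra.
- exact: ltW.
Qed.

Lemma kap_le k n : kap al k n <= 1 - al ^+ k.
Proof.
elim: k n => [|k IH] n; first by rewrite /= expr0 subrr.
rewrite /= exprS.
have : al * kap al k n./2 <= al * (1 - al ^+ k) by rewrite ler_pM2l.
by case: (odd n) => /=; alra.
Qed.

Lemma kap_01 k n : 0 <= kap al k n <= 1.
Proof. by rewrite kap_ge0 (le_trans (kap_le k n))// gerBl ltW// alX_gt0. Qed.

(** Among words of length [k.+1] other than all ones, the largest code has its only zero in the last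
    digit. The bound keeps these codes where [falphak al k.+1] still agrees with [falpha al]. *)
Lemma kap_le_pred k n : ~~ (2 ^ k.+1 %| n.+1)%N ->
  kap al k.+1 n <= 1 - al ^+ k.
Proof.
elim: k n => [|k IH] n.
  by rewrite dvdn2 /= negbK => /negbTE -> /=; rewrite expr0; alra.
move=> h; rewrite [kap _ _ _]/= -/(kap al k.+1 _) exprS.
have := kap_le k.+1 n./2; have p0 := alX_gt0 k.+1.
have p1 := alX_le1 k.
case on: (odd n); rewrite [_%:R]/= => hk.
  have {}hk : kap al k.+1 n./2 <= 1 - al ^+ k.
    apply: IH; apply: contra h => /dvdnP[q hq].
    by apply/dvdnP; exists q; rewrite expnS; lia.
  rewrite -(ler_pM2l al0) in hk; alra.
have : al * kap al k.+1 n./2 <= al * 1 by rewrite ler_pM2l//; alra.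
have : al * al ^+ k <= al * 1 by rewrite ler_pM2l.
by alra.
Qed.

(** Equal first digits only scale the difference by [al]. At the first differing digit the gap
    [1 - al] beats the tails, worth at most [al * (1 - al ^+ k)], by more than [al ^+ k.+1] because
    [al < 1/2]. *)
Lemma kap_sep k a b : a != b %[mod 2 ^ k] ->
  al ^+ k < `|kap al k a - kap al k b|.
Proof.
elim: k a b => [|k IH] a b; first by rewrite expn0 !modn1.
move=> hab; rewrite exprS /=.
have p0 := alX_gt0 k; have p1 := alX_le1 k.
have ka := kap_ge0 k a./2; have kb := kap_ge0 k b./2.
have la := kap_le k a./2; have lb := kap_le k b./2.
have [e|ne] := eqVneq (odd a) (odd b).
  rewrite e [X in `|X|](_ : _ = al * (kap al k a./2 - kap al k b./2)); last by ring.
  rewrite normrM gtr0_norm// ltr_pM2l//; apply: IH.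
  apply: contra hab => /eqP h.
  rewrite -(odd_double_half a) -(odd_double_half b) e -!mul2n expnS.
  rewrite eqn_modDl; apply/eqP.
  by rewrite -!muln_modr h.
have aka : 0 <= al * kap al k a./2 by apply: mulr_ge0 => //; apply: ltW.
have akb : 0 <= al * kap al k b./2 by apply: mulr_ge0 => //; apply: ltW.
have ala : al * kap al k a./2 <= al * (1 - al ^+ k) by rewrite ler_pM2l.
have alb : al * kap al k b./2 <= al * (1 - al ^+ k) by rewrite ler_pM2l.
have ap : 0 < al * al ^+ k by rewrite mulr_gt0.
rewrite ltr_normr.
by case: (odd a) (odd b) ne => [] [] //= _; apply/orP; [left|right]; alra.
Qed.

Lemma kap_inj k a b : kap al k a = kap al k b -> a = b %[mod 2 ^ k].
Proof.
move=> e; apply/eqP/negPn/negP => /kap_sep.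
by rewrite e subrr normr0 ltNge ltW// alX_gt0.
Qed.

(** Without a carry the digits add exactly. With one, two ones worth [2 * (1 - al)] give way to a
    zero, and the whole tail behind it is worth at most [al], which is less. *)
Lemma kap_subadd k a b : kap al k (a + b) <= kap al k a + kap al k b.
Proof.
elim: k a b => [|k IH] a b; first by rewrite /= addr0.
rewrite /= oddD halfD.
have k1 n : al * kap al k n <= al.
  by rewrite ger_pMr//; case/andP: (kap_01 k n).
have k0 n : 0 <= al * kap al k n.
  by apply: mulr_ge0; [exact: ltW|exact: kap_ge0].
have := IH a./2 b./2; rewrite -(ler_pM2l al0) => h.
have h1 := k1 (a./2 + b./2).+1; have ha := k0 a./2; have hb := k0 b./2.
case: (odd a) (odd b) => [] [] /=; rewrite ?add0n ?add1n; alra.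
Qed.

End alpha.
End kap.

(** * The map and its renormalization *)

Lemma exprn_lt_eps (R : realType) (q e : R) : 0 < q < 1 -> 0 < e ->
  exists k, q ^+ k < e.
Proof.
move=> /andP[q0 q1] e0; have : q ^+ n @[n --> \oo] --> (0 : R).
  by apply: cvg_expr; rewrite ger0_norm// ltW.
move=> /cvgrPdist_lt /(_ _ e0) [N _ /(_ N (leqnn N))].
by rewrite sub0r normrN gtr0_norm ?exprn_gt0// => ?; exists N.
Qed.

Section falpha.
Context {R : realType}.
Variable al : R.
Hypothesis hal : 0 < al < 2^-1.
Implicit Types x y z : R.

Let al0 : 0 < al. Proof. by case/andP: hal. Qed.

Ltac alra := have /andP[? ?] := hal; lra.

Lemma level_ex x : 0 <= x < 1 -> exists j, 1 - al ^+ j <= x < 1 - al ^+ j.+1.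
Proof.
move=> /andP[x0 x1].
have ex : exists j, x < 1 - al ^+ j.
  have [||k hk] := @exprn_lt_eps _ al (1 - x); [alra|by rewrite subr_gt0|].
  by exists k; rewrite ltrBrDr addrC -ltrBrDr.
case: (ex_minnP ex) => -[|j]; first by rewrite expr0; lra.
move=> xj min; exists j; rewrite xj andbT leNgt; apply/negP => /min.
by rewrite ltnn.
Qed.

Lemma falpha_low x : 0 <= x <= al -> falpha al x = x + 1 - al.
Proof.
move=> hx; rewrite (@falpha_left _ al x 1)//= ?expr0 ?expr1; lra.
Qed.

Lemma falpha_gap x : al < x < 1 - al ->
  falpha al x =
    (1 - al + al ^+ 2) / (2 * al - 1) * (x - 1)
    + al ^+ 2 * ((2 - al) / (2 * al - 1)).
Proof.
by move=> hx; rewrite (@falpha_right _ al x 1)//= ?expr0 ?expr1//; lra.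
Qed.

Lemma falpha1 : falpha al 1 = 0.
Proof. by rewrite /falpha eqxx. Qed.

(** Passing from z to [1 - al + al * z] raises the level by one and scales each branch by [al]. The
    point 1 lies in no level and is checked separately. *)
Lemma falpha_self z : 0 <= z <= 1 -> falpha al (1 - al + al * z) = al * falpha al z.
Proof.
move=> /andP[z0]; rewrite le_eqVlt => /orP[/eqP ->|z1].
  by rewrite mulr1 subrK falpha1 mulr0.
have [j /andP[jl jr]] := @level_ex z (introT andP (conj z0 z1)).
have [zm|zm] := leP z (1 - al ^+ j + al ^+ j.+1).
  rewrite (@falpha_left _ al z j.+1)//=; last by rewrite jl.
  rewrite (@falpha_left _ al _ j.+2)//=; first by rewrite !exprS; ring.
  rewrite -(ler_pM2l al0) in jl; rewrite -(ler_pM2l al0) in zm.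
  by rewrite !exprS in jl zm *; lra.
rewrite (@falpha_right _ al z j.+1)//=; last by rewrite zm.
rewrite (@falpha_right _ al _ j.+2)//=; first by rewrite !exprS; ring.
rewrite -(ltr_pM2l al0) in jr; rewrite -(ltr_pM2l al0) in zm.
by rewrite !exprS in jr zm *; lra.
Qed.

(** Induction on an upper bound for the level: left of [1 - al] the branches are bounded directly,
    and the rest is a smaller copy with a lower level. *)
Lemma falpha_01 x : 0 <= x <= 1 -> 0 <= falpha al x <= 1.
Proof.
move=> /andP[x0]; rewrite le_eqVlt => /orP[/eqP ->|x1].
  by rewrite falpha1 lexx ler01.
have [j /andP[_]] := @level_ex x (introT andP (conj x0 x1)).
elim: j.+1 x x0 x1 => [|{}j IH] x x0 x1 xj.
  by move: xj; rewrite expr0; lra.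
have [xl|xl] := leP x al; first by rewrite falpha_low ?x0//; alra.
have [xr|xr] := ltP x (1 - al).
  rewrite falpha_gap ?xl//.
  have d0 : 0 < 1 - 2 * al by alra.
  have -> : (1 - al + al ^+ 2) / (2 * al - 1) * (x - 1)
    + al ^+ 2 * ((2 - al) / (2 * al - 1)) =
    ((1 - al + al ^+ 2) * (1 - x) - al ^+ 2 * (2 - al)) / (1 - 2 * al).
    by field; apply/andP; split; apply/negP => /eqP; lra.
  rewrite ler_pdivlMr// ler_pdivrMr//.
  have A0 : 0 < 1 - al + al ^+ 2 by have := exprn_gt0 2 al0; alra.
  have lo : (1 - al + al ^+ 2) * al < (1 - al + al ^+ 2) * (1 - x).
    by rewrite ltr_pM2l//; lra.
  have hi : (1 - al + al ^+ 2) * (1 - x) < (1 - al + al ^+ 2) * (1 - al).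
    by rewrite ltr_pM2l//; lra.
  (* This product is the numerator at the right end [1 - al] of the gap. At the left end [al] the
     numerator equals [1 - 2 * al], so the value there is 1. *)
  have pos : 0 < al * (1 - al) * (1 - 2 * al) by rewrite !mulr_gt0//; alra.
  by apply/andP; split; lra.
pose z := (x - (1 - al)) / al.
have xz : x = 1 - al + al * z.
  by rewrite /z mulrC divfK ?gt_eqF//; ring.
have z0 : 0 <= z by apply: divr_ge0; [rewrite subr_ge0|exact: ltW].
have z1 : z < 1 by rewrite -(ltr_pM2l al0); lra.
have zj : z < 1 - al ^+ j by rewrite -(ltr_pM2l al0); rewrite exprS in xj; lra.
rewrite xz falpha_self; last by rewrite z0 ltW.
have /andP[f0 f1] := IH z z0 z1 zj.
rewrite mulr_ge0 ?(ltW al0)//=.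
by apply: (@le_trans _ _ (al * 1)); [rewrite ler_pM2l|alra].
Qed.

Lemma iter_falpha_01 n x : 0 <= x <= 1 -> 0 <= iter n (falpha al) x <= 1.
Proof. by move=> hx; elim: n => //= n IH; exact: falpha_01. Qed.

(** A first digit 0 is turned into 1 by the translation branch, with no carry. A first digit 1 puts
    the point in [[1 - al, 1]], where [falpha_self] resets the digit and carries to the tail. Only a
    carry through all [k] digits reaches z. *)
Lemma falpha_kap k a z : 0 <= z <= 1 ->
  falpha al (kap al k a + al ^+ k * z) =
  kap al k a.+1 + al ^+ k * (if (2 ^ k %| a.+1)%N then falpha al z else z).
Proof.
elim: k a z => [|k IH] a z hz.
  by rewrite expn0 dvd1n /= expr0 !add0r !mul1r.
have k0 := kap_ge0 hal k a./2; have k1 := kap_le hal k a./2.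
have p0 := alX_gt0 hal k.
have w01 : 0 <= kap al k a./2 + al ^+ k * z <= 1.
  have : 0 <= al ^+ k * z <= al ^+ k * 1.
    by have /andP[? ?] := hz; rewrite mulr_ge0 ?(ltW p0)// ler_pM2l.
  by lra.
rewrite /= exprS; case oa: (odd a) => /=; last first.
  rewrite mulr0 add0r -mulrA -mulrDr falpha_low; last first.
    by have /andP[? ?] := w01; rewrite mulr_ge0 ?(ltW al0)//= ger_pMr.
  rewrite ifN; last first.
    apply/negP => h; have : (2 %| a.+1)%N by apply: dvdn_trans h; rewrite expnS dvdn_mulr.
    by rewrite dvdn2 /= oa.
  by rewrite uphalf_half oa add0n; ring.
rewrite mulr1 -mulrA -addrA -mulrDr falpha_self// IH// mulr0 add0r.
have -> : uphalf a = a./2.+1 by rewrite uphalf_half oa.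
rewrite mulrDr mulrA.
rewrite -[X in (_ = _ + al * _ * (if (_ %| X)%N then _ else _))]
  (_ : (2 * a./2.+1 = a.+1)%N).
  by rewrite expnS dvdn_pmul2l.
by rewrite -[in RHS](odd_double_half a) oa; lia.
Qed.

(** The quotient counts the overflows of the odometer, each of which applies the map once to z. *)
Lemma iter_falpha_kap k a n z : (a < 2 ^ k)%N -> 0 <= z <= 1 ->
  iter n (falpha al) (kap al k a + al ^+ k * z) =
  kap al k (a + n) + al ^+ k * iter ((a + n) %/ 2 ^ k) (falpha al) z.
Proof.
move=> ak hz; elim: n => [|n IH]; first by rewrite addn0 divn_small.
rewrite /= IH falpha_kap; last exact: iter_falpha_01.
rewrite addnS; congr (_ + _ * _).
by rewrite divnS ?expn_gt0//; case: ifP.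
Qed.

(* The middle branch expands, so its fixed point is the only point that never
   leaves it. *)
Definition fixpt : R := (1 - al ^+ 2) / (2 - al).

Let slope : R := (1 - al + al ^+ 2) / (1 - 2 * al).

Lemma falpha_gap_fixpt x : al < x < 1 - al ->
  falpha al x - fixpt = - (slope * (x - fixpt)).
Proof.
move=> hx; rewrite falpha_gap// /fixpt /slope.
by field; apply/and3P; split; apply/negP => /eqP; alra.
Qed.

Lemma fixpt_gap : al < fixpt < 1 - al.
Proof.
have a20 : 0 < 2 - al by alra.
have a2 : al ^+ 2 = al * al by rewrite expr2.
rewrite /fixpt ltr_pdivlMr// ltr_pdivrMr//.
by apply/andP; split; have /andP[? ?] := hal; nra.
Qed.

Lemma falpha_fixpt : falpha al fixpt = fixpt.
Proof.
by apply/eqP; rewrite -subr_eq0 falpha_gap_fixpt ?fixpt_gap// subrr mulr0 oppr0.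
Qed.

Lemma falpha_dichotomy z : 0 <= z <= 1 ->
  z = fixpt \/ exists n,
    let y := iter n (falpha al) z in y <= al \/ 1 - al <= y.
Proof.
move=> hz; have [ex|nex] := pselect (exists n,
    let y := iter n (falpha al) z in y <= al \/ 1 - al <= y); first by right.
left; have gap n : al < iter n (falpha al) z < 1 - al.
  rewrite !ltNge -negb_or; apply/negP => /orP h; apply: nex.
  by exists n.
have d0 : 0 < 1 - 2 * al by alra.
have s1 : 1 < slope.
  by rewrite ltr_pdivlMr// mul1r; have := exprn_gt0 2 al0; alra.
have s0 : 0 < slope by exact: lt_trans s1.
have sn n : `|iter n (falpha al) z - fixpt| = slope ^+ n * `|z - fixpt|.
  elim: n => [|n IH]; first by rewrite mul1r.
  rewrite iterS falpha_gap_fixpt// normrN normrM IH gtr0_norm//.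
  by rewrite exprS mulrA.
apply/eqP; rewrite -subr_eq0 -normr_eq0; apply/negPn/negP => nz.
have zp : 0 < `|z - fixpt| by rewrite lt_def nz normr_ge0.
(* Once [slope ^+ n] exceeds the inverse of the initial distance, the n-th iterate is more than 1
   away from [fixpt], which is impossible inside the gap. *)
have [||n] := @exprn_lt_eps _ slope^-1 `|z - fixpt| => //.
  by rewrite invr_gt0 s0 invf_lt1.
rewrite exprVn ltNge => /negP; apply.
rewrite -[leRHS]mulr1 ler_pdivlMl ?exprn_gt0// -sn.
have := gap n; have := fixpt_gap; rewrite ler_norml; alra.
Qed.

End falpha.

(** * Orbits landing on the fixed point of some renormalization, and orbits following codes of every
    length *)

Section orbits.
Context {R : realType}.
Variable al : R.
Hypothesis hal : 0 < al < 2^-1.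
Implicit Types x y z : R.

Let al0 : 0 < al. Proof. by case/andP: hal. Qed.

Ltac alra := have /andP[? ?] := hal; lra.

Local Notation f := (falpha al).

(** Here [z] is the position inside the interval of a word of length [k], rescaled so that the
    interval becomes [0, 1]. *)
Definition reaches_code k x z :=
  exists N a, (a < 2 ^ k)%N /\ iter N f x = kap al k a + al ^+ k * z.

(** Every [2 ^ k] steps the code returns and the map acts once on the rescaled position. *)
Lemma reaches_code_iter k x z m : 0 <= z <= 1 ->
  reaches_code k x z -> reaches_code k x (iter m f z).
Proof.
move=> hz [N [a [ak xN]]]; exists (m * 2 ^ k + N)%N, a; split => //.
rewrite iterD xN iter_falpha_kap// kap_modD.
by rewrite divnDMl ?expn_gt0// divn_small.
Qed.

Lemma reaches_code_refine k x y (b : bool) : 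
  reaches_code k x ((1 - al) * b%:R + al * y) -> reaches_code k.+1 x y.
Proof.
move=> [N [a [ak xN]]]; exists N, (a + b * 2 ^ k)%N; split.
  by rewrite expnS; case: b xN => _; lia.
by rewrite xN kapD// exprS; case: b {xN} => /=; ring.
Qed.

(** Codes are lengthened digit by digit: unless the rescaled position is the fixed point, it
    eventually leaves the gap, and the side on which it lands is the next digit. *)
Lemma orbit_dichotomy x : 0 <= x <= 1 ->
  (exists k, reaches_code k x (fixpt al)) \/
  (forall k, exists2 z, 0 <= z <= 1 & reaches_code k x z).
Proof.
move=> hx; have [|nA] := pselect (exists k, reaches_code k x (fixpt al)).
  by left.
right; elim=> [|k [z hz xz]].
  by exists x => //; exists 0%N, 0%N; rewrite /= expr0 add0r mul1r.
have [zp|[m /= zm]] := falpha_dichotomy hal hz.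
  by case: nA; exists k; rewrite -zp.
have := iter_falpha_01 hal m hz; have := @reaches_code_iter _ _ _ m hz xz.
move: (iter m f z) zm => y zm xy /andP[y0 y1].
have [b yb] : exists b : bool, 0 <= y - (1 - al) * b%:R <= al.
  by case: zm => zm; [exists false|exists true] => /=; alra.
exists ((y - (1 - al) * b%:R) / al).
  by have /andP[? ?] := yb; rewrite ler_pdivrMr// ler_pdivlMr// mul0r mul1r.
apply: (@reaches_code_refine _ _ _ b).
by rewrite mulrCA divff ?gt_eqF// mulr1 addrC subrK.
Qed.

Lemma reaches_fixpt_iter k x : reaches_code k x (fixpt al) ->
  exists N a, forall n,
    iter (n + N) f x = kap al k (a + n) + al ^+ k * fixpt al.
Proof.
move=> [N [a [ak xN]]]; exists N, a => n; rewrite iterD xN iter_falpha_kap//.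
  by rewrite iter_fix// falpha_fixpt.
by have := fixpt_gap hal; alra.
Qed.

(** After a period the point returns, so the codes before and after differ by at most [al ^+ k]. By
    [kap_sep] they are then the same residue. *)
Lemma reaches_code_period k x z q : 0 <= z <= 1 -> reaches_code k x z ->
  eventual_period f x q -> (2 ^ k %| q)%N.
Proof.
move=> hz [N [a [ak xN]]] [q0 [i iq]].
have e : iter (q + i) f (iter N f x) = iter i f (iter N f x).
  have := congr1 (iter N f) (iq 1%N); rewrite mul1n -!iterD => h.
  by rewrite (addnC (q + i)%N) addnA h addnC.
move: e; rewrite xN !iter_falpha_kap//.
have /andP[] := iter_falpha_01 hal ((a + (q + i)) %/ 2 ^ k) hz.
have /andP[] := iter_falpha_01 hal ((a + i) %/ 2 ^ k) hz.
move: (iter _ f z) (iter _ f z) => u v u0 u1 v0 v1 e.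
have p0 := alX_gt0 hal k.
have : ~~ (a + (q + i) != a + i %[mod 2 ^ k]).
  apply/negP => /(kap_sep hal); apply/negP; rewrite -leNgt.
  have -> : kap al k (a + (q + i)) - kap al k (a + i) = al ^+ k * (v - u) by lra.
  rewrite normrM (gtr0_norm p0) ger_pMr// ler_norml.
  by apply/andP; split; lra.
rewrite negbK addnCA -[X in _ == X %[mod _]]add0n eqn_modDr mod0n.
by rewrite /dvdn.
Qed.

Lemma reaches_fixpt_period k x : reaches_code k x (fixpt al) ->
  eventually_periodic_of_period f x (2 ^ k).
Proof.
move=> xp; have h01 : 0 <= fixpt al <= 1 by have := fixpt_gap hal; alra.
split; last first.
  by move=> q hq; rewrite dvdn_leq ?(reaches_code_period h01 xp hq)//; case: hq.
split; first by rewrite expn_gt0.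
have [N [a h]] := reaches_fixpt_iter xp.
exists N => m; rewrite -iterD h kap_modD.
by have := h 0%N; rewrite add0n addn0.
Qed.

Lemma period_reaches_fixpt k x : 0 <= x <= 1 ->
  eventually_periodic_of_period f x (2 ^ k) -> reaches_code k x (fixpt al).
Proof.
move=> hx [xk min]; have [[j xj]|xz] := orbit_dichotomy hx.
  have [pj minj] := reaches_fixpt_period xj.
  suff -> : k = j by [].
  by apply/eqP; rewrite -(eqn_exp2l _ _ (ltnSn 1)) eqn_leq min// minj.
(* Codes of length [2 ^ k] would make [2 ^ (2 ^ k)] divide the period [2 ^ k], which is smaller. *)
have [z hz xz'] := xz (2 ^ k)%N.
have := reaches_code_period hz xz' xk => /dvdn_leq; rewrite expn_gt0 => /(_ isT).
by rewrite leqNgt ltn_expl.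
Qed.

Lemma aperiodic_reaches_code x : 0 <= x <= 1 -> ~ eventually_periodic f x ->
  forall k, exists2 z, 0 <= z <= 1 & reaches_code k x z.
Proof.
move=> hx np; have [[j xj]|//] := orbit_dichotomy hx.
by case: np; exists (2 ^ j)%N; case: (reaches_fixpt_period xj).
Qed.

(** Comparing differences instead of positions cancels a constant offset from the codes, so [e = 0]
    is attained in the eventually periodic case. *)
Definition shadowed k e x := exists N a, forall i j, (N <= i)%N -> (N <= j)%N ->
  `|(iter i f x - iter j f x) - (kap al k (a + i) - kap al k (a + j))| <= e.

(** The term [N * (2 ^ k).-1] stands for -N modulo [2 ^ k], so the phase can be expressed in
    absolute time without truncated subtraction. *)
Lemma kap_unshift k a N i : (N <= i)%N ->
  kap al k (a + N * (2 ^ k).-1 + i) = kap al k (a + (i - N)).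
Proof.
move=> Ni; rewrite -(kap_modD al k (a + (i - N)) N); congr kap.
by have := expn_gt0 2 k; case: (2 ^ k)%N => //= m _; rewrite mulnS; lia.
Qed.

Lemma reaches_fixpt_shadowed k x : reaches_code k x (fixpt al) ->
  shadowed k 0 x.
Proof.
move=> /reaches_fixpt_iter [N [a h]].
exists N, (a + N * (2 ^ k).-1)%N => i j Ni Nj; rewrite !kap_unshift//.
rewrite -{1}(subnK Ni) -{1}(subnK Nj) !h.
by rewrite [X in `|X|](_ : _ = 0) ?normr0//; lra.
Qed.

Lemma reaches_code_shadowed k x z : 0 <= z <= 1 -> reaches_code k x z ->
  shadowed k (al ^+ k) x.
Proof.
move=> hz [N [a [ak xN]]].
exists N, (a + N * (2 ^ k).-1)%N => i j Ni Nj; rewrite !kap_unshift//.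
rewrite -{1}(subnK Ni) -{1}(subnK Nj) !iterD xN !iter_falpha_kap//.
have /andP[] := iter_falpha_01 hal ((a + (i - N)) %/ 2 ^ k) hz.
have /andP[] := iter_falpha_01 hal ((a + (j - N)) %/ 2 ^ k) hz.
move: (iter _ f z) (iter _ f z) => u v u0 u1 v0 v1.
have p0 := alX_gt0 hal k.
rewrite [X in `|X|](_ : _ = al ^+ k * (u - v)); last by lra.
rewrite normrM (gtr0_norm p0) ger_pMr// ler_norml.
by apply/andP; split; lra.
Qed.

End orbits.

(** * Counting pairs and runs *)

Section counting.
Local Open Scope nat_scope.
Implicit Types (S T : nat -> nat -> bool) (p : nat -> bool) (n k M N : nat).

Definition cnt n S : nat := (\sum_(i < n) \sum_(j < n) S i j).

Lemma card_cnt n S :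
  #|[set ij : 'I_n * 'I_n | S ij.1 ij.2]%SET| = cnt n S.
Proof.
rewrite -sum1_card /cnt pair_bigA /= big_mkcond /=.
by apply: eq_bigr => ij _; rewrite inE; case: (S _ _).
Qed.

Lemma eq_cnt n S T : (forall i j, (i < n) -> (j < n) -> S i j = T i j) ->
  cnt n S = cnt n T.
Proof. by move=> h; apply: eq_bigr => i _; apply: eq_bigr => j _; rewrite h. Qed.

Lemma leq_cnt n S (u : nat -> nat -> nat) :
  (forall i j, (i < n) -> (j < n) -> (S i j <= u i j)) ->
  (cnt n S <= \sum_(i < n) \sum_(j < n) u i j).
Proof. by move=> h; apply: leq_sum => i _; apply: leq_sum => j _; apply: h. Qed.

Lemma sum_shift (u : nat -> nat) n k :
  (\sum_(i < n) (if k <= i then u (i - k) else 0) = \sum_(i < n - k) u i).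
Proof.
have [kn|nk] := leqP k n; last first.
  rewrite (_ : n - k = 0) ?big_ord0; last by lia.
  by rewrite big1// => i _; rewrite ifN// -ltnNge (ltn_trans _ nk).
have -> : n = (k + (n - k)) by lia.
rewrite addKn big_split_ord /= big1 ?add0n => [|i _].
  by apply: eq_bigr => i _; rewrite leq_addr addKn.
by rewrite ifN// -ltnNge.
Qed.

Lemma sum_lt_bound n N : (\sum_(i < n) (i < N) <= N).
Proof.
elim: n => [|n IH]; first by rewrite big_ord0.
rewrite big_ord_recr /=; case: ltnP => nN; last by rewrite addn0.
rewrite addn1; apply: leq_ltn_trans nN.
by rewrite -[leqRHS](card_ord n) -sum1_card; apply: leq_sum => i _; exact: leq_b1.
Qed.

Lemma cnt_shift n k S :
  cnt n (fun i j => [&& k <= i, k <= j & S (i - k) (j - k)]) = cnt (n - k) S.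
Proof.
rewrite /cnt -(sum_shift (fun i => \sum_(j < n - k) S i j) n k).
apply: eq_bigr => i _; case: (leqP k i) => ki /=; last by rewrite big1.
rewrite -(sum_shift (fun j => S (i - k) j : nat) n k).
by apply: eq_bigr => j _; case: leqP.
Qed.

(** The first [N] rows and columns hold at most [2 * N * n] pairs, so a transient costs a term
    linear in n. *)
Lemma cnt_leq_lt n N S T :
  (forall i j, (i < n) -> (j < n) -> S i j ->
     [|| T i j, (i < N) | (j < N)]) ->
  (cnt n S <= cnt n T + 2 * N * n).
Proof.
move=> h; have {h}/leq_cnt : forall i j, (i < n) -> (j < n) ->
    (S i j <= (T i j + (i < N)) + (j < N)).
  move=> i j hi hj; move: (h i j hi hj).
  by case: (S i j); case: (T i j); case: (i < N); case: (j < N) => // /(_ isT).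
move=> /leq_trans; apply.
rewrite (eq_bigr (fun i : 'I_n => \sum_(j < n) T i j +
    (n * (i < N) + \sum_(j < n) (j < N)))); last first.
  by move=> i _; rewrite !big_split /= sum_nat_const card_ord addnA.
rewrite big_split /= leq_add2l big_split /= -big_distrr /= sum_nat_const card_ord.
have := sum_lt_bound n N; set s := (\sum_(_ < _) _). nia.
Qed.

Lemma leq_cnt_size m n S : (m <= n) -> (cnt m S <= cnt n S).
Proof.
have mono (u : nat -> nat) : (m <= n -> \sum_(i < m) u i <= \sum_(i < n) u i).
  by move=> mn; rewrite -(subnKC mn) big_split_ord leq_addr.
move=> mn; apply: (@leq_trans (\sum_(i < m) \sum_(j < n) S i j)).
  by apply: leq_sum => i _; apply: (mono (fun j => S i j : nat)).
exact: (mono (fun i => \sum_(j < n) S i j)).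
Qed.

Lemma cnt_subn n k S : (cnt n S <= cnt (n - k) S + 2 * k * n).
Proof.
have row (u : nat -> bool) (s q : nat) : (\sum_(j < q) u (s + j) <= q).
  by rewrite -[leqRHS]card_ord -sum1_card; apply: leq_sum => j _; exact: leq_b1.
have [kn|nk] := leqP k n; last first.
  apply: (@leq_trans (\sum_(i < n) n)); last by rewrite sum_nat_const card_ord; nia.
  by apply: leq_sum => i _; exact: (row (S i) 0).
have [m ->] : exists m, n = m + k by exists (n - k); rewrite subnK.
rewrite addnK /cnt big_split_ord /=.
apply: (@leq_trans (\sum_(i < m) (\sum_(j < m) S i j + k) + \sum_(i < k) (m + k))).
  apply: leq_add; apply: leq_sum => i _; last exact: (row (S (m + i)) 0).
  by rewrite big_split_ord leq_add2l; exact: (row (S i) m).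
by rewrite big_split /= !sum_nat_const !card_ord; nia.
Qed.

Section periodic.
Variables (M : nat) (S : nat -> nat -> bool).
Hypotheses (M_gt0 : (0 < M)).
Hypotheses (Sl : forall i j, S (i + M) j = S i j).
Hypotheses (Sr : forall i j, S i (j + M) = S i j).

Lemma sum_periodic (u : nat -> nat) q : (forall i, u (i + M) = u i) ->
  (\sum_(i < q * M) u i = q * \sum_(i < M) u i).
Proof.
move=> uM; elim: q => [|q IH]; first by rewrite !mul0n big_ord0.
rewrite mulSn addnC big_split_ord /= IH mulSn addnC; congr (_ + _).
apply: eq_bigr => i _; elim: {IH}q => [|q IH]; first by rewrite mul0n.
by rewrite mulSn -addnA addnC uM.
Qed.

Lemma cnt_periodic q : cnt (q * M) S = (q ^ 2 * cnt M S).
Proof.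
rewrite /cnt (eq_bigr (fun i : 'I__ => q * \sum_(j < M) S i j)); last first.
  by move=> i _; rewrite (sum_periodic (u := fun j => S i j : nat))// => j; rewrite Sr.
rewrite -big_distrr /= (sum_periodic (u := fun i => \sum_(j < M) S i j)).
  by rewrite mulnA.
by move=> i; apply: eq_bigr => j _; rewrite Sl.
Qed.

Lemma cnt_periodic_bounds n :
  ((n %/ M) ^ 2 * cnt M S <= cnt n S <= (n %/ M).+1 ^ 2 * cnt M S).
Proof.
rewrite -!cnt_periodic !leq_cnt_size// ?leq_trunc_div//.
by rewrite ltnW// -ltn_divLR.
Qed.

Lemma sum_periodic_shift (u : nat -> nat) a : (forall i, u (i + M) = u i) ->
  (\sum_(i < M) u (a + i) = \sum_(i < M) u i).
Proof.
move=> uM; elim: a => [|a <-]; first by apply: eq_bigr.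
move: M_gt0 uM; case: M => // m _ uM.
rewrite big_ord_recr [RHS]big_ord_recl /= addnC; congr (_ + _).
  by rewrite addSnnS uM addn0.
by apply: eq_bigr => i _; rewrite addSnnS.
Qed.

Lemma cnt_periodic_shift a : cnt M (fun i j => S (a + i) (a + j)) = cnt M S.
Proof.
rewrite /cnt -[RHS](@sum_periodic_shift (fun i => \sum_(j < M) S i j) a).
  apply: eq_bigr => i _.
  by rewrite (@sum_periodic_shift (fun j => S (a + i) j : nat))// => j; rewrite Sr.
by move=> i; apply: eq_bigr => j _; rewrite Sl.
Qed.

End periodic.

(** * Runs along diagonals *)

Section runs.
Variables (P : nat -> nat -> bool).

Definition run l i j : bool := all (fun t => P (i + t) (j + t)) (iota 0 l).

Definition in_run l m i j : bool :=
  has (fun k => run l (i - k) (j - k)) (iota 0 m.+1).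

(** Marks the last start of a length-[l] run in a maximal diagonal stretch; each finite stretch of
    length at least [l] has exactly one. *)
Definition run_end l i j : bool := run l i j && ~~ run l.+1 i j.

Lemma runP l i j :
  reflect (forall t, (t < l) -> P (i + t) (j + t)) (run l i j).
Proof.
apply: (iffP allP) => h t; first by move=> tl; apply: h; rewrite mem_iota.
by rewrite mem_iota => /andP[_]; exact: h.
Qed.

Lemma cnt_run l n : cnt n (run l) = (cnt n (run_end l) + cnt n (run l.+1)).
Proof.
rewrite /cnt -big_split /=; apply: eq_bigr => i _.
rewrite -big_split /=; apply: eq_bigr => j _.
rewrite /run_end; case: (boolP (run l.+1 i j)) => [/runP h|_].
  rewrite andbF (_ : run l i j = true)//.
  by apply/runP => t tl; apply: h; apply: ltnW.
by rewrite andbT addn0.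
Qed.

(* A pair lying in a run of length l at distance at most m from some run start
   is charged to the nearest one. *)
Lemma in_run_sum l m i j : (m < l) -> (m <= i) -> (m <= j) ->
  in_run l m i j = (run l i j + \sum_(k < m) run_end l (i - k.+1) (j - k.+1))
    :> nat.
Proof.
elim: m => [|m IH] ml mi mj.
  by rewrite /in_run /= orbF !subn0 big_ord0 addn0.
rewrite big_ord_recr /= addnA -IH; try lia.
rewrite /in_run -[m.+2]addn1 iotaD has_cat add0n [has _ (iota _ 1)]/= orbF -/(in_run l m i j).
(* Given a run starting [m.+1] steps back, it extends by one step exactly when some run starts at
   most [m] steps back: such a run also covers the missing position, since [m.+1 < l.+1]. *)
suff -> : run_end l (i - m.+1) (j - m.+1) =
    ~~ in_run l m i j && run l (i - m.+1) (j - m.+1).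
  by case: in_run; case: run.
rewrite /run_end andbC; case: (boolP (run l _ _)) => [/runP ha|]; rewrite ?andbF//.
rewrite !andbT; congr negb; apply/runP/hasP => [h|[k]].
  exists m; first by rewrite mem_iota add0n ltnSn.
  apply/runP => t tl; have := h t.+1 tl.
  by rewrite !addnS -!addSn !subnSK//; apply: leq_trans; rewrite ?leq_subr.
rewrite mem_iota add0n => /andP[_ km] /runP h t.
rewrite ltnS leq_eqVlt => /orP[/eqP ->|]; last exact: ha.
have := h (l.-1 + k - m).
have -> : (i - k + (l.-1 + k - m) = i - m.+1 + l) by lia.
have -> : (j - k + (l.-1 + k - m) = j - m.+1 + l) by lia.
by apply; lia.
Qed.

(** Summed over all pairs, the starts at distance [k.+1] give a count of [run_end] over the box of
    size [n - k.+1]. Enlarging each of the fewer than [l] boxes to size n costs at most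
    [2 * l * n]. *)
Lemma cnt_in_run l n : (0 < l) ->
  let m i j := minn (minn i j) l.-1 in
  let B i j := in_run l (m i j) i j in
  (cnt n B <= cnt n (run l) + l.-1 * cnt n (run_end l)) /\
  (cnt n (run l) + l.-1 * cnt n (run_end l) <= cnt n B + 2 * l ^ 2 * n).
Proof.
move=> l0 m B.
have cntB : cnt n B = (cnt n (run l) + \sum_(k < l.-1) cnt (n - k.+1) (run_end l)).
  transitivity (cnt n (run l) + \sum_(k < l.-1)
    cnt n (fun i j => [&& k.+1 <= i, k.+1 <= j & run_end l (i - k.+1) (j - k.+1)])).
    rewrite /cnt [X in _ = _ + X]exchange_big -big_split /=; apply: eq_bigr => i _.
    rewrite [X in _ = _ + X]exchange_big -big_split /=; apply: eq_bigr => j _.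
    rewrite /B in_run_sum; try by rewrite /m; lia.
    congr (_ + _).
    (* The indices from [m i j] up to [l.-1] contribute nothing: there [k.+1] exceeds i or j. *)
    rewrite [RHS](bigID (fun k : 'I_l.-1 => (k < m i j))) /= [X in (_ = _ + X)]big1 ?addn0.
      rewrite -(big_ord_widen_cond l.-1 xpredT (fun k =>
        [&& k.+1 <= i, k.+1 <= j & run_end l (i - k.+1) (j - k.+1)] : nat)); last by rewrite /m; lia.
      apply: eq_bigr => k _; have := ltn_ord k; rewrite {2}/m => km.
      have ki : k < i by lia.
      have kj : k < j by lia.
      by rewrite ki kj.
    move=> k; rewrite /m => km; have := ltn_ord k => kl.
    by case: (ltnP k i) => //= ki; rewrite ltnNge (_ : j <= k)//; lia.
  by congr (_ + _); apply: eq_bigr => k _; exact: (cnt_shift n k.+1).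
rewrite cntB leq_add2l; split.
  apply: (@leq_trans (\sum_(k < l.-1) cnt n (run_end l))).
    by apply: leq_sum => k _; apply: leq_cnt_size; exact: leq_subr.
  by rewrite sum_nat_const card_ord.
rewrite -addnA leq_add2l -[X in (X * _ <= _)]card_ord -sum_nat_const.
apply: (@leq_trans (\sum_(k < l.-1) (cnt (n - k.+1) (run_end l) + 2 * l * n))).
  apply: leq_sum => k _; apply: leq_trans (cnt_subn n k.+1 _) _.
  rewrite leq_add2l leq_mul2r leq_mul2l /= orbC; have := ltn_ord k; lia.
rewrite big_split leq_add2l /= sum_nat_const card_ord.
by rewrite expnS expn1; nia.
Qed.

End runs.
End counting.

(** * Densities of periodic relations and squeezed sequences *)

Section density.
Context {R : realType}.
Implicit Types (S T : nat -> nat -> bool) (n M N : nat).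

Definition density M S : R := (cnt M S)%:R / M%:R ^+ 2.

(** With q the quotient of n by [M], the count and its main term both lie between [q ^ 2] and
    [(q + 1) ^ 2] times the count of one period block. *)
Lemma cnt_periodic_real M S n : (0 < M)%N ->
  (forall i j, S (i + M)%N j = S i j) -> (forall i j, S i (j + M)%N = S i j) ->

  `|(cnt n S)%:R - n%:R ^+ 2 * density M S| <= (cnt M S)%:R * (2 * n%:R + 1).
Proof.
move=> M0 Sl Sr; set K : R := (cnt M S)%:R; have := cnt_periodic_bounds M0 Sl Sr n.
have M1 : 1 <= M%:R :> R by rewrite ler1n.
have -> : n%:R ^+ 2 * density M S = K * (n%:R / M%:R) ^+ 2.
  by rewrite /density -/K; field; lra.
have qn := leq_trunc_div n M; have nq := ltn_ceil n M0.
move: (n %/ M)%N qn nq => q qn nq /andP[lo hi].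
have Kge0 : 0 <= K by rewrite ler0n.
have {lo}lo : q%:R ^+ 2 * K <= (cnt n S)%:R by rewrite -natrX -natrM ler_nat.
have {hi}hi : (cnt n S)%:R <= (q%:R + 1) ^+ 2 * K.
  by rewrite natr1 -natrX -natrM ler_nat.
have q0 : 0 <= q%:R :> R by rewrite ler0n.
set w := n%:R / M%:R.
have qw : q%:R <= w by rewrite ler_pdivlMr ?(lt_le_trans ltr01)// -natrM ler_nat.
have wq : w < q%:R + 1.
  by rewrite ltr_pdivrMr ?(lt_le_trans ltr01)// natr1 -natrM ltr_nat.
have wn : w <= n%:R.
  by rewrite ler_pdivrMr ?(lt_le_trans ltr01)// ler_peMr.
rewrite ler_norml; apply/andP; split.
  have : K * (w ^+ 2 - q%:R ^+ 2) <= (cnt M S)%:R * (2 * n%:R + 1).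
    by rewrite ler_wpM2l//; nra.
  by lra.
have : K * ((q%:R + 1) ^+ 2 - w ^+ 2) <= (cnt M S)%:R * (2 * n%:R + 1).
  by rewrite ler_wpM2l//; nra.
by lra.
Qed.

Lemma density_upper M N S T : (0 < M)%N ->
  (forall i j, T (i + M)%N j = T i j) -> (forall i j, T i (j + M)%N = T i j) ->
  (forall i j, (N <= i)%N -> (N <= j)%N -> S i j -> T i j) ->
  exists D, forall n, (0 < n)%N ->
    (cnt n S)%:R / n%:R ^+ 2 <= density M T + D / n%:R.
Proof.
(* The first summand absorbs the periodic error, as [2 * n + 1 <= 3 * n]; the second pays for the
   rows and columns below [N]. *)
move=> M0 Tl Tr ST; exists (3 * (cnt M T)%:R + 2 * N%:R) => n n0.
have /ler_normlP[_] := cnt_periodic_real n M0 Tl Tr.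
have : (cnt n S <= cnt n T + 2 * N * n)%N.
  apply: cnt_leq_lt => i j _ _; case: (leqP N i) => Ni; last by rewrite orbT.
  by case: (leqP N j) => Nj; rewrite ?orbT//= orbF; apply: ST.
rewrite -(ler_nat R) natrD !natrM => h1 h2.
have n1 : 1 <= n%:R :> R by rewrite ler1n.
have n0' : 0 < n%:R :> R by lra.
rewrite ler_pdivrMr ?exprn_gt0// mulrDl.
rewrite [_ / n%:R * _](_ : _ = (3 * (cnt M T)%:R + 2 * N%:R) * n%:R); last first.
  by field; rewrite gt_eqF.
have : (cnt M T)%:R * 1 <= (cnt M T)%:R * n%:R :> R by rewrite ler_wpM2l.
by lra.
Qed.

Lemma density_lower M N S T : (0 < M)%N ->
  (forall i j, T (i + M)%N j = T i j) -> (forall i j, T i (j + M)%N = T i j) ->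
  (forall i j, (N <= i)%N -> (N <= j)%N -> T i j -> S i j) ->
  exists D, forall n, (0 < n)%N ->
    density M T - D / n%:R <= (cnt n S)%:R / n%:R ^+ 2.
Proof.
move=> M0 Tl Tr TS; exists (3 * (cnt M T)%:R + 2 * N%:R) => n n0.
have /ler_normlP[+ _] := cnt_periodic_real n M0 Tl Tr.
have : (cnt n T <= cnt n S + 2 * N * n)%N.
  apply: cnt_leq_lt => i j _ _; case: (leqP N i) => Ni; last by rewrite orbT.
  by case: (leqP N j) => Nj; rewrite ?orbT//= orbF; apply: TS.
rewrite -(ler_nat R) natrD !natrM => h1 h2.
have n1 : 1 <= n%:R :> R by rewrite ler1n.
have n0' : 0 < n%:R :> R by lra.
rewrite ler_pdivlMr ?exprn_gt0// mulrBl.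
rewrite [_ / n%:R * _](_ : _ = (3 * (cnt M T)%:R + 2 * N%:R) * n%:R); last first.
  by field; rewrite gt_eqF.
have : (cnt M T)%:R * 1 <= (cnt M T)%:R * n%:R :> R by rewrite ler_wpM2l.
by lra.
Qed.

Lemma inv_n_lt (D e : R) : 0 < e -> \forall n \near \oo, (0 < n)%N /\ D / n%:R < e.
Proof.
move=> e0; exists (Num.truncn (`|D| / e)).+1 => // n /= hn.
have n0 : (0 < n)%N by apply: leq_trans hn.
split => //; rewrite ltr_pdivrMr ?ltr0n//.
apply: le_lt_trans (ler_norm D) _.
rewrite mulrC -ltr_pdivrMr//; apply: lt_le_trans (truncnS_gt _) _.
by rewrite ler_nat.
Qed.

(** The constant [D] may depend on [k]: n tends to infinity first, at fixed [k]. *)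
Definition squeezed (lo hi u : nat -> R) :=
  forall k, exists D, forall n, (0 < n)%N ->
    lo k - D / n%:R <= u n <= hi k + D / n%:R.

Lemma squeezed_cvg lo hi u L : squeezed lo hi u ->
  (forall e, 0 < e -> exists k, hi k - lo k < e) ->
  (forall k, lo k <= L <= hi k) -> u @ \oo --> L.
Proof.
move=> sq tight hL; apply/cvgrPdist_lt => e e0.
have [k hk] := tight (e / 2) (divr_gt0 e0 (ltr0Sn R 1)).
have [D hD] := sq k.
apply: filterS (inv_n_lt D (divr_gt0 e0 (ltr0Sn R 1))) => n [n0 Dn].
have /andP[? ?] := hD n n0; have /andP[? ?] := hL k.
by rewrite ltr_norml; apply/andP; split; lra.
Qed.

(** The limit is the supremum of [lo]. Monotonicity in [k] is not assumed: every [lo k] is below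
    every [hi k'] because both bound [u] up to O(1/n). *)
Lemma squeezed_cvg_ex lo hi u : squeezed lo hi u ->
  (forall e, 0 < e -> exists k, hi k - lo k < e) ->
  exists2 L, (forall k, lo k <= L <= hi k) & u @ \oo --> L.
Proof.
move=> sq tight.
have lohi k k' : lo k <= hi k'.
  rewrite leNgt; apply/negP => h.
  have [D hD] := sq k; have [D' hD'] := sq k'.
  have e0 : 0 < lo k - hi k' by rewrite subr_gt0.
  have [n _ hn] := inv_n_lt (D + D') e0.
  have [n0 Dn] := hn n (leqnn n); rewrite mulrDl in Dn.
  by have /andP[? ?] := hD n n0; have /andP[? ?] := hD' n n0; lra.
have hs : has_sup (range lo).
  split; first by exists (lo 0%N), 0%N.
  by exists (hi 0%N) => _ [k _ <-].
have hL k : lo k <= sup (range lo) <= hi k; last first.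
  by exists (sup (range lo)) => //; exact: squeezed_cvg sq tight hL.
apply/andP; split.
  by apply: sup_upper_bound => //; exists k.
by apply: sup_le_ub => [|_ [k' _ <-]]; [case: hs|].
Qed.

End density.

(** * Pair densities of the odometer *)

Section model.
Context {R : realType}.
Variable al : R.
Hypothesis hal : 0 < al < 2^-1.
Implicit Types (x y z r e : R) (k : nat) (ell : option nat).

Definition code_close k ell r (a b : nat) : bool :=
  `[< forall t, lt_ell t ell ->
        `|kap al k (a + t) - kap al k (b + t)| <= r >].

(** For [ell >= 1] this is also the correlation integral of [falphak al k], by
    [corr_int_mu_alphak]. *)
Definition model_corr k ell r : R := density (2 ^ k) (code_close k ell r).

Lemma code_close_addl k ell r a b : code_close k ell r (a + 2 ^ k) b = code_close k ell r a b.
Proof.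
apply: asbool_equiv_eq; split => h t ht; have := h t ht;
by rewrite addnAC -[X in kap al k (a + t + X)]mul1n kap_modD.
Qed.

Lemma code_close_addr k ell r a b : code_close k ell r a (b + 2 ^ k) = code_close k ell r a b.
Proof.
apply: asbool_equiv_eq; split => h t ht; have := h t ht;
by rewrite addnAC -[X in kap al k (b + t + X)]mul1n kap_modD.
Qed.

Lemma model_corr_gt0 k ell r : 0 <= r -> 0 < model_corr k ell r.
Proof.
move=> r0; rewrite divr_gt0 ?exprn_gt0 ?ltr0n ?expn_gt0//.
have -> : cnt (2 ^ k) (code_close k ell r) =
  (\sum_(i < 2 ^ k) \sum_(j < 2 ^ k) code_close k ell r i j)%N by [].
case e : (2 ^ k)%N (expn_gt0 2 k) => [//|m] _.
rewrite big_ord_recl big_ord_recl -addnA ltn_addr// lt0b.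
by apply/asboolP => t _; rewrite subrr normr0.
Qed.

(** Distinct codes are more than [al ^+ k] apart, so a closed window of that length holds at most
    one. The map [h] reindexes the residues injectively. *)
Lemma window_le1 k z (h : nat -> nat) :
  (forall b b', (b < 2 ^ k)%N -> (b' < 2 ^ k)%N ->
     h b = h b' %[mod 2 ^ k] -> b = b') ->
  (\sum_(b < 2 ^ k) (z <= kap al k (h b) <= z + al ^+ k)%R <= 1)%N.
Proof.
move=> hinj; rewrite -big_mkcond sum1_card.
apply/card_le1P => b; rewrite unfold_in => /andP[b1 b2] b'.
rewrite inE unfold_in; apply/idP/eqP => [/andP[b1' b2']|->]; last first.
  by rewrite b1.
apply/val_inj/hinj; rewrite ?ltn_ord//.
apply/eqP/negPn/negP => /(kap_sep hal); rewrite ltNge => /negP; apply.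
by rewrite ler_norml; apply/andP; split; lra.
Qed.

(** The annulus lies in two intervals of length [2 * al ^+ k], hence in four windows. *)
Lemma annulus_le4 k r c (h : nat -> nat) :
  (forall b b', (b < 2 ^ k)%N -> (b' < 2 ^ k)%N ->
     h b = h b' %[mod 2 ^ k] -> b = b') ->
  (\sum_(b < 2 ^ k)
     (r - al ^+ k <= `|c - kap al k (h b)| <= r + al ^+ k)%R <= 4)%N.
Proof.
move=> hinj.
have w z := window_le1 z hinj.
apply: (@leq_trans (1 + 1 + 1 + 1)%N) => //.
apply: leq_trans (leq_add (leq_add (leq_add (w (c + r - al ^+ k))
  (w (c + r))) (w (c - r - al ^+ k))) (w (c - r))).
rewrite -!big_split /=; apply: leq_sum => b _.
case: (boolP (_ <= `|_| <= _)) => // /andP[].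
set v := kap _ _ _; rewrite ler_norml ler_normr => h1 /andP[h2 h3].
set e := al ^+ k in h1 h2 h3 *.
suff : [|| c + r - e <= v <= c + r - e + e, c + r <= v <= c + r + e,
    c - r - e <= v <= c - r - e + e | c - r <= v <= c - r + e].
  by do 4 case: (_ <= v <= _).
have [d|d] := orP h1.
  have [d'|d'] := leP v (c - r).
    by apply/or4P/Or43; apply/andP; split; lra.
  by apply/or4P/Or44; apply/andP; split; lra.
have [d'|d'] := leP v (c + r).
  by apply/or4P/Or41; apply/andP; split; lra.
by apply/or4P/Or42; apply/andP; split; lra.
Qed.

(** A union bound: for each a, each of the [L] tests leaves at most four choices of b. *)
Lemma cnt_annuli k r L (S T : nat -> nat -> bool) (c : nat -> nat -> R)
    (h : nat -> nat -> nat -> nat) :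
  (forall t a, (t < L)%N -> (a < 2 ^ k)%N ->
     forall b b', (b < 2 ^ k)%N -> (b' < 2 ^ k)%N ->
     h t a b = h t a b' %[mod 2 ^ k] -> b = b') ->
  (forall a b, (a < 2 ^ k)%N -> (b < 2 ^ k)%N -> S a b -> ~~ T a b ->
     exists2 t, (t < L)%N &
       r - al ^+ k <= `|c t a - kap al k (h t a b)| <= r + al ^+ k) ->
  (cnt (2 ^ k) S <= cnt (2 ^ k) T + 4 * L * 2 ^ k)%N.
Proof.
move=> hinj ST; set M := (2 ^ k)%N.
pose I t a b : bool :=
  r - al ^+ k <= `|c t a - kap al k (h t a b)| <= r + al ^+ k.
apply: leq_trans (leq_cnt (u := fun a b => T a b + \sum_(t < L) I t a b)%N _) _.
  move=> a b ha hb; case Sab : (S a b) => //.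
  case Tab : (T a b) => //; rewrite add0n.
  have [|t tL It] := ST _ _ ha hb Sab; first by rewrite Tab.
  by rewrite (bigD1 (Ordinal tL))//= /I It.
rewrite (eq_bigr (fun a : 'I_M => \sum_(b < M) T a b +
    \sum_(t < L) \sum_(b < M) I t a b)%N); last first.
  by move=> a _; rewrite big_split /= [X in (_ + X)%N]exchange_big.
rewrite big_split leq_add2l /=.
apply: (@leq_trans (\sum_(a < M) \sum_(t < L) 4)%N).
  by apply: leq_sum => a _; apply: leq_sum => t _; apply/annulus_le4/hinj.
by rewrite !sum_nat_const !card_ord; lia.
Qed.

Lemma addn_modr_inj M t b b' : (b < M)%N -> (b' < M)%N ->
  (b + t = b' + t %[mod M])%N -> b = b'.
Proof. by move=> hb hb' /eqP; rewrite eqn_modDr !modn_small// => /eqP. Qed.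

Lemma subn_modr_inj M t b b' : (b < M)%N -> (b' < M)%N ->
  (t + (M - b) = t + (M - b') %[mod M])%N -> b = b'.
Proof.
move=> hb hb' /eqP; rewrite eqn_modDl => /eqP h.
apply: (@addn_modr_inj M (M - b) b b') => //.
rewrite -[RHS]modnDmr h modnDmr !subnKC//; exact: ltnW.
Qed.

(** A pair close at the larger radius but not at the smaller has, at some time, a distance in the
    annulus. For finite [ell] each time is one test; for infinite [ell] two tests replace all
    times. *)
Lemma cnt_code_close k ell r : exists2 L, (L <= (odflt 2 ell))%N &
  (cnt (2 ^ k) (code_close k ell (r + al ^+ k)) <=
   cnt (2 ^ k) (code_close k ell (r - al ^+ k)) + 4 * L * 2 ^ k)%N.
Proof.
have not_close a b s : ~~ code_close k ell s a b -> exists2 t, lt_ell t ell &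
    s < `|kap al k (a + t) - kap al k (b + t)|.
  move=> /asboolPn h; apply: contrapT => nex; apply: h => t ht.
  by rewrite leNgt; apply/negP => ?; apply: nex; exists t.
case: ell not_close => [l|] not_close /=.
  exists l => //; apply: (@cnt_annuli _ r l _ _ (fun t a => kap al k (a + t))
      (fun t a b => b + t)%N).
    by move=> t a _ _ b b'; exact: addn_modr_inj.
  move=> a b _ _ /asboolP hi /not_close[t tl lo]; exists t => //.
  by rewrite ltW//= hi.
(* For infinite l the distance of a and b is the larger of kap (a - b) and
   kap (b - a), by subadditivity. *)
exists 2%N => //; set M := (2 ^ k)%N.
apply: (@cnt_annuli _ r 2 _ _ (fun _ _ => 0)
  (fun t a b => if t is 0 then a + (M - b) else b + (M - a))%N).
  move=> [|t] a _ aM b b' bM b'M; first exact: subn_modr_inj.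
  exact: addn_modr_inj.
move=> a b aM bM /asboolP hi /not_close[t _ lo].
have kM : kap al k M = 0 by apply: kap_dvd.
(* At time [M - b] the second code is 0, so the distance there is the code of a - b modulo [M]. *)
have hab : kap al k (a + (M - b)) <= r + al ^+ k.
  have := hi (M - b)%N isT; rewrite subnKC ?kM ?subr0; last exact: ltnW.
  by rewrite ger0_norm// kap_ge0.
have hba : kap al k (b + (M - a)) <= r + al ^+ k.
  have := hi (M - a)%N isT; rewrite subnKC ?kM ?sub0r ?normrN; last exact: ltnW.
  by rewrite ger0_norm// kap_ge0.
have sub c d : (d < M)%N ->
    kap al k (c + t) <= kap al k (d + t) + kap al k (c + (M - d)).
  move=> dM; apply: le_trans (kap_subadd hal k _ _).
  have -> : (d + t + (c + (M - d)) = c + t + 1 * M)%N by lia.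
  by rewrite kap_modD.
have s1 := sub a b bM; have s2 := sub b a aM.
have : r - al ^+ k <= kap al k (a + (M - b)) \/ r - al ^+ k <= kap al k (b + (M - a)).
  have [|lt1] := leP (r - al ^+ k) (kap al k (a + (M - b))); first by left.
  by right; move: lo; rewrite ltr_normr => /orP[]; lra.
case=> h; [exists 0%N|exists 1%N] => //;
by rewrite sub0r normrN ger0_norm ?kap_ge0// h.
Qed.

(** The excess pairs number O(2^k) out of 4^k. *)
Lemma model_corr_tight ell r e : 0 < e ->
  exists k, model_corr k ell (r + al ^+ k) - model_corr k ell (r - al ^+ k) < e.
Proof.
move=> e0; pose L : R := 4 * (odflt 2 ell)%:R + 1.
have L0 : 0 < L by rewrite ltr_wpDl// mulr_ge0.
have [||k hk] := @exprn_lt_eps R 2^-1 (e / L); [lra|exact: divr_gt0|].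
exists k; apply: le_lt_trans (_ : L * 2^-1 ^+ k < _); last first.
  by rewrite mulrC -ltr_pdivlMr.
have [l lell] := cnt_code_close k ell r.
rewrite -(ler_nat R) natrD !natrM natrX.
rewrite /model_corr /density natrX exprVn => h.
have p0 : 0 < 2 ^+ k :> R by exact: exprn_gt0.
rewrite -mulrBl ler_pdivrMr ?exprn_gt0//.
rewrite [leRHS](_ : _ = L * 2 ^+ k); last by field; rewrite gt_eqF.
have : 4 * l%:R * 2 ^+ k <= L * 2 ^+ k.
  rewrite ler_pM2r// /L; have : l%:R <= (odflt 2 ell)%:R :> R by rewrite ler_nat.
  by lra.
by lra.
Qed.

End model.

(** * Recurrence quantities along an orbit *)

Section recurrence.
Context {R : realType}.
Implicit Types (g : R -> R) (x y r : R) (ell : option nat).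

(** [ell_ge1] makes the set of distances nonempty and orbits in [0, 1] make it bounded, so [sup] is
    a true supremum. *)
Lemma varrho_le g ell x y r : ell_ge1 ell ->
  (forall t, 0 <= iter t g x <= 1) -> (forall t, 0 <= iter t g y <= 1) ->
  varrho g ell x y <= r <->
  forall t, lt_ell t ell -> `|iter t g x - iter t g y| <= r.
Proof.
move=> ell1 hx hy.
have ell0 : lt_ell 0 ell by case: ell ell1.
rewrite /varrho; set A := [set _ | _ in _].
have Aub : ubound A 1.
  move=> _ [t _ <-]; have /andP[? ?] := hx t; have /andP[? ?] := hy t.
  by rewrite ler_norml; apply/andP; split; lra.
have A0 : A !=set0.
  by exists `|iter 0 g x - iter 0 g y|; exists 0%N.
split=> [h t ht|h]; last by apply: ge_sup => // _ [t ht <-]; exact: h.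
apply: le_trans h; apply: ub_le_sup; first by exists 1.
by exists t.
Qed.

Variables (g : R -> R) (x : R).
Hypothesis gx01 : forall n, 0 <= iter n g x <= 1.
Variable r : R.

Let near i j := `|iter i g x - iter j g x| <= r.

Lemma varrho_orbit_le ell i j : ell_ge1 ell ->
  varrho g ell (iter i g x) (iter j g x) <= r <->
  forall t, lt_ell t ell -> near (i + t) (j + t).
Proof.
move=> ell1; rewrite varrho_le//; try by move=> t; rewrite -iterD.
by split=> h t ht; have := h t ht; rewrite /near -!iterD ![(t + _)%N]addnC.
Qed.

Definition orbit_close ell i j := varrho g ell (iter i g x) (iter j g x) <= r.

Lemma corr_sumE ell n :
  corr_sum g ell x n r = (cnt n (orbit_close ell))%:R / n%:R ^+ 2.
Proof. by rewrite /corr_sum (card_cnt n (orbit_close ell)). Qed.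

Lemma orbit_close_run l i j : (0 < l)%N -> orbit_close (Some l) i j = run near l i j.
Proof.
move=> l0; have e := @varrho_orbit_le (Some l) i j l0.
by apply/idP/runP => [/e.1|/e.2].
Qed.

Lemma rec_rate1 n : rec_rate g (Some 1%N) x n r = corr_sum g (Some 1%N) x n r.
Proof.
rewrite /rec_rate /corr_sum; congr (_%:R / _); apply: eq_card => ij.
rewrite !inE /= minn0; apply/existsP/idP => [[k]|h].
  by rewrite (ord1 k) !subn0.
by exists ord0; rewrite !subn0.
Qed.

(** A pair that was close forever k steps earlier is still close forever, so [k = 0] already
    witnesses it. *)
Lemma rec_rate_infty n : rec_rate g None x n r = corr_sum g None x n r.
Proof.
rewrite /rec_rate /corr_sum; congr (_%:R / _); apply: eq_card => ij.
rewrite !inE /=; apply/existsP/idP => [[k]|h]; last first.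
  by exists ord0; rewrite !subn0.
have := ltn_ord k; rewrite ltnS leq_min => /andP[k1 k2].
move=> /(@varrho_orbit_le None _ _ isT).1 h.
apply/(@varrho_orbit_le None _ _ isT) => t _.
have := h (k + t)%N isT.
by rewrite !addnA !subnK.
Qed.

Lemma rec_rateE l n : (0 < l)%N ->
  rec_rate g (Some l) x n r =
  (cnt n (fun i j => in_run near l (minn (minn i j) l.-1) i j))%:R / n%:R ^+ 2.
Proof.
move=> l0; rewrite /rec_rate -card_cnt; congr (_%:R / _); apply: eq_card => ij.
rewrite !inE /=; apply/existsP/hasP => [[k hk]|[k]].
  exists (k : nat); first by rewrite mem_iota add0n ltn_ord.
  by rewrite -orbit_close_run.
rewrite mem_iota => /= km; rewrite -orbit_close_run// => h.
by exists (Ordinal km).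
Qed.

Lemma rec_rate_dist l : (0 < l)%N -> exists D, forall n, (0 < n)%N ->
  `|l%:R * corr_sum g (Some l) x n r - (l%:R - 1) * corr_sum g (Some l.+1) x n r
    - rec_rate g (Some l) x n r| <= D / n%:R.
Proof.
move=> l0; exists (2 * l%:R ^+ 2) => n n0.
rewrite rec_rateE// !corr_sumE.
rewrite (@eq_cnt n (orbit_close (Some l)) (run near l)); last first.
  by move=> i j _ _; rewrite orbit_close_run.
rewrite (@eq_cnt n (orbit_close (Some l.+1)) (run near l.+1)); last first.
  by move=> i j _ _; rewrite orbit_close_run.
have [] := cnt_in_run near n l0; have := cnt_run near l n.
move: (cnt n (run near l)) (cnt n (run near l.+1)) (cnt n (run_end _ _)).
move=> a a' e; move: l0; case: l => // l _ /= ->; move: (cnt n _) => b h1 h2.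
have n0' : 0 < n%:R :> R by rewrite ltr0n.
(* Runs of length [l.+1] number [e + a'], so [l.+1] times this minus [l * a'] equals
   [e + a' + l * e], the quantity bounded by [cnt_in_run]. *)
rewrite [X in `|X|](_ : _ = ((e + a' + l * e)%N%:R - b%:R) / n%:R ^+ 2); last first.
  by rewrite -[l.+1%:R]natr1 !natrD natrM; field; rewrite gt_eqF//.
rewrite normrM ger0_norm; last by rewrite subr_ge0 ler_nat; lia.
rewrite ger0_norm ?invr_ge0 ?exprn_ge0 ?ler0n//.
rewrite ler_pdivrMr ?exprn_gt0// [leRHS](_ : _ = (2 * l.+1 ^ 2 * n)%N%:R); last first.
  by rewrite !natrM; field; rewrite gt_eqF.
by rewrite lerBlDr -natrD ler_nat; lia.
Qed.

End recurrence.

(** * Convergence of correlation sums, recurrence rates and determinism *)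

Section limits.
Context {R : realType}.
Variable al : R.
Hypothesis hal : 0 < al < 2^-1.
Implicit Types (x r e : R) (k : nat) (ell : option nat).

Local Notation f := (falpha al).

Lemma near_cvg (u v : nat -> R) (D L : R) :
  (forall n, (0 < n)%N -> `|u n - v n| <= D / n%:R) ->
  u @ \oo --> L -> v @ \oo --> L.
Proof.
move=> uv uL; apply/cvgrPdist_lt => e e0.
have e2 : 0 < e / 2 by rewrite divr_gt0.
have /cvgrPdist_lt/(_ _ e2) hu := uL.
apply: filterS2 hu (inv_n_lt D e2) => n h1 [n0 h2].
have h3 := uv n n0.
rewrite (_ : L - v n = (L - u n) + (u n - v n)); last by ring.
by apply: le_lt_trans (ler_normD _ _) _; lra.
Qed.

Lemma rec_rate_cvg (g : R -> R) x r l (c c' : R) : (0 < l)%N ->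
  (forall n, 0 <= iter n g x <= 1) ->
  (fun n => corr_sum g (Some l) x n r) @ \oo --> c ->
  (fun n => corr_sum g (Some l.+1) x n r) @ \oo --> c' ->
  (fun n => rec_rate g (Some l) x n r) @ \oo --> l%:R * c - (l%:R - 1) * c'.
Proof.
move=> l0 gx hc hc'; have [D hD] := rec_rate_dist gx r l0.
by apply: (near_cvg hD); apply: cvgB; apply: cvgMr.
Qed.

(** The formula of [det_int] for an arbitrary family, usable before the limits are identified with
    integrals. *)
Definition det_of (c : option nat -> R) ell : R :=
  (if ell is Some l then l%:R * c (Some l) - (l%:R - 1) * c (Some l.+1)
   else c None) / c (Some 1%N).

Lemma determinism_cvg (g : R -> R) x r (c : option nat -> R) :
  (forall n, 0 <= iter n g x <= 1) ->
  (forall ell, ell_ge1 ell ->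
     (fun n => corr_sum g ell x n r) @ \oo --> c ell) ->
  0 < c (Some 1%N) ->
  forall ell, ell_ge1 ell ->
    (fun n => determinism g ell x n r) @ \oo --> det_of c ell.
Proof.
move=> gx hc c1 ell ell1; rewrite /determinism /det_of.
apply: cvgM; last first.
  apply: cvgV; first by rewrite gt_eqF.
  under eq_fun do rewrite rec_rate1.
  exact: hc.
case: ell ell1 => [l|] l0.
  by apply: rec_rate_cvg => //; exact: hc.
under eq_fun do rewrite (rec_rate_infty gx).
exact: hc.
Qed.

(** After the transient, orbit and code distances differ by at most [e] at every time, so closeness
    at one radius passes to the other at the cost of [e]. *)
Lemma shadowed_corr k e x ell r : 0 <= x <= 1 -> ell_ge1 ell ->
  shadowed al k e x -> exists D, forall n, (0 < n)%N ->
    model_corr al k ell (r - e) - D / n%:R <= corr_sum f ell x n r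
      <= model_corr al k ell (r + e) + D / n%:R.
Proof.
move=> hx ell1 [N [a sh]].
have fx n := iter_falpha_01 hal n hx.
pose T s i j := code_close al k ell s (a + i)%N (a + j)%N.
have M0 : (0 < 2 ^ k)%N by rewrite expn_gt0.
have Tl s i j : T s (i + 2 ^ k)%N j = T s i j by rewrite /T addnA code_close_addl.
have Tr s i j : T s i (j + 2 ^ k)%N = T s i j by rewrite /T addnA code_close_addr.
(* The phase [a] only permutes the residues modulo [2 ^ k]. *)
have TE s : model_corr al k ell s = density (2 ^ k) (T s).
  congr (_%:R / _).
  rewrite -(@cnt_periodic_shift (2 ^ k) (code_close al k ell s) M0 _ _ a)//.
    exact: code_close_addl.
  exact: code_close_addr.
pose S := orbit_close f x r ell.
have hi i j : (N <= i)%N -> (N <= j)%N -> S i j -> T (r + e) i j.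
  move=> Ni Nj /(varrho_orbit_le fx _ _ _ ell1).1 h; apply/asboolP => t ht.
  have h1 := h t ht.
  have h2 := sh (i + t)%N (j + t)%N (leq_trans Ni (leq_addr _ _)) (leq_trans Nj (leq_addr _ _)).
  rewrite -!addnA.
  set w := _ - kap _ _ _ in h2 *; set v := _ - iter _ _ _ in h1 h2.
  rewrite (_ : w = v - (v - w)); last by ring.
  by apply: le_trans (ler_normB _ _) _; rewrite lerD.
have lo i j : (N <= i)%N -> (N <= j)%N -> T (r - e) i j -> S i j.
  move=> Ni Nj /asboolP h; apply/(varrho_orbit_le fx _ _ _ ell1) => t ht.
  have h1 := h t ht.
  have h2 := sh (i + t)%N (j + t)%N (leq_trans Ni (leq_addr _ _)) (leq_trans Nj (leq_addr _ _)).
  rewrite -!addnA in h1.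
  set w := _ - kap _ _ _ in h1 h2; set v := _ - iter _ _ _ in h2 *.
  rewrite (_ : v = (v - w) + w); last by ring.
  by apply: le_trans (ler_normD _ _) _; lra.
have [D1 hD1] := @density_upper R _ _ _ _ M0 (Tl _) (Tr _) hi.
have [D2 hD2] := @density_lower R _ _ _ _ M0 (Tl _) (Tr _) lo.
exists (`|D1| + `|D2|) => n n0; rewrite corr_sumE !TE.
have n1 : 0 <= n%:R^-1 :> R by rewrite invr_ge0.
have D1n : D1 / n%:R <= (`|D1| + `|D2|) / n%:R.
  by rewrite ler_wpM2r// (le_trans (ler_norm _))// lerDl.
have D2n : D2 / n%:R <= (`|D1| + `|D2|) / n%:R.
  by rewrite ler_wpM2r// (le_trans (ler_norm _))// lerDr.
by have := hD1 n n0; have := hD2 n n0; rewrite -/S => ? ?; apply/andP; split; lra.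
Qed.

Lemma fixpt_corr_cvg k x ell r : 0 <= x <= 1 -> ell_ge1 ell ->
  reaches_code al k x (fixpt al) ->
  (fun n => corr_sum f ell x n r) @ \oo --> model_corr al k ell r.
Proof.
move=> hx ell1 /(reaches_fixpt_shadowed hal) sh.
have := shadowed_corr r hx ell1 sh; rewrite subr0 addr0 => h.
pose c (_ : nat) := model_corr al k ell r.
apply: (@squeezed_cvg _ c c) => [j|e e0|j]; first exact: h.
  by exists 0%N; rewrite subrr.
by rewrite lexx.
Qed.

Lemma code_corr_squeezed x ell r : 0 <= x <= 1 -> ell_ge1 ell ->
  (forall k, exists2 z, 0 <= z <= 1 & reaches_code al k x z) ->
  squeezed (fun k => model_corr al k ell (r - al ^+ k))
           (fun k => model_corr al k ell (r + al ^+ k))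
           (fun n => corr_sum f ell x n r).
Proof.
move=> hx ell1 hz k; have [z z01 xz] := hz k.
by apply: shadowed_corr => //; exact: reaches_code_shadowed xz.
Qed.

(* Below scale r the bracket is bounded away from 0 by the diagonal pairs. *)
Lemma bracket_gt0 ell r (c : R) : 0 < r ->
  (forall k, model_corr al k ell (r - al ^+ k) <= c
               <= model_corr al k ell (r + al ^+ k)) -> 0 < c.
Proof.
move=> r0 hc; have [||k hk] := @exprn_lt_eps _ al r => //.
  by have /andP[? ?] := hal; lra.
have /andP[h _] := hc k; apply: lt_le_trans h.
by apply: model_corr_gt0; rewrite subr_ge0 ltW.
Qed.

End limits.

(** * Correlation integrals *)

Section rectangles.
Local Open Scope ereal_scope.

Lemma sum_measureI_le d (T : measurableType d) (R : realType)
    (m : {measure set T -> \bar R}) (F : nat -> set T) n (A : set T) :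
  (forall i, measurable (F i)) -> trivIset setT F -> measurable A ->
  \sum_(i < n) m (A `&` F i) <= m A.
Proof.
move=> mF tF mA.
rewrite -(measure_bigsetU m (F := fun i => A `&` F i)).
- apply: le_measure; rewrite ?inE//.
    by apply: bigsetU_measurable => i _; exact: measurableI.
  by rewrite -(bigcup_mkord n (fun i => A `&` F i)); apply: bigcup_sub => i _ z [].
- by move=> i; exact: measurableI.
- exact: trivIset_setIl.
Qed.

Context {R : realType}.
Local Notation RM := (measurableTypeR R).
Variables (P : probability RM R) (M : nat) (I : nat -> set RM).
Hypotheses (mI : forall i, measurable (I i)) (tI : trivIset setT I).
Hypothesis PI : forall i, (i < M)%N -> P (I i) = (M%:R^-1)%:E.
Variables (A : set (RM * RM)) (S : nat -> nat -> bool).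
Hypothesis mA : measurable A.

(** The selected cells are disjoint subsets of [A] of mass [M ^- 2] each. Disjointness is used one
    coordinate at a time, through vertical and horizontal strips. *)
Lemma density_le_product :
  (forall i j, (i < M)%N -> (j < M)%N -> S i j -> I i `*` I j `<=` A) ->
  ((density M S)%:E <= (P \x P) A).
Proof.
move=> SA; pose F1 i := I i `*` [set: RM]; pose F2 i := [set: RM] `*` I i.
have mF1 i : measurable (F1 i) by apply: measurableX.
have mF2 i : measurable (F2 i) by apply: measurableX.
have tF1 : trivIset setT F1.
  apply/trivIsetP => i j _ _ ij; rewrite /F1 -setXI setIT.
  by move/trivIsetP : tI => /(_ _ _ Logic.I Logic.I ij) ->; rewrite set0X.
have tF2 : trivIset setT F2.
  apply/trivIsetP => i j _ _ ij; rewrite /F2 -setXI setIT.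
  by move/trivIsetP : tI => /(_ _ _ Logic.I Logic.I ij) ->; rewrite setX0.
apply: le_trans (@sum_measureI_le _ _ _ (P \x P) F1 M A mF1 tF1 mA).
apply: (@le_trans _ _ (\sum_(i < M) \sum_(j < M) (P \x P) (A `&` F1 i `&` F2 j))); last first.
  apply: lee_sum => i _.
  by apply: sum_measureI_le => //; exact: measurableI.
rewrite /density /cnt natr_sum mulr_suml -sumEFin; apply: lee_sum => i _.
rewrite natr_sum mulr_suml -sumEFin; apply: lee_sum => j _.
case Sij : (S i j); last by rewrite mul0r.
have -> : A `&` F1 i `&` F2 j = I i `*` I j.
  rewrite -setIA /F1 /F2 -setXI setIT setTI setIidr//.
  by apply: SA; rewrite ?ltn_ord.
rewrite mul1r product_measure1E//.
have -> : (M%:R ^- 2)%:E = P (I i) * P (I j) by rewrite !PI// -EFinM -invfM expr2.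
exact: lexx.
Qed.

End rectangles.

Section rectangle_bounds.
Context {R : realType}.
Local Notation RM := (measurableTypeR R).
Variables (P : probability RM R) (M : nat) (I : nat -> set RM).
Hypotheses (mI : forall i, measurable (I i)) (tI : trivIset setT I).
Hypothesis PI : forall i, (i < M)%N -> P (I i) = (M%:R^-1)%:E.
Variables (A : set (RM * RM)).
Hypothesis mA : measurable A.
Hypothesis M0 : (0 < M)%N.

(** The lower bound is applied to the complement of [A] and the negation of [S], whose density is
    one minus that of [S]. *)
Lemma product_le_density (S : nat -> nat -> bool) :
  (forall i j, (i < M)%N -> (j < M)%N ->
     forall x y, I i x -> I j y -> A (x, y) -> S i j) ->
  ((P \x P) A <= (density M S)%:E)%E.
Proof.
move=> AS; pose nS i j := ~~ S i j.
have := density_le_product (S := nS) mI tI PI (measurableC mA).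
move=> /(_ _)/wrap[i j iM jM nSij [x y] [/= Ix Iy] Axy|].
  by move: nSij; rewrite /nS (AS i j iM jM x y Ix Iy Axy).
rewrite probability_setC//.
have -> : density M nS = 1 - density M S :> R.
  apply/eqP; rewrite -subr_eq opprK /density -mulrDl -natrD.
  rewrite (_ : _ + _ = M ^ 2)%N ?natrX ?divff ?expf_neq0 ?pnatr_eq0 -?lt0n//.
  rewrite /cnt -big_split /= (eq_bigr (fun=> M)); last first.
    move=> i _; rewrite -big_split /= (eq_bigr (fun=> 1%N)).
      by rewrite sum_nat_const card_ord muln1.
    by move=> j _; rewrite /nS; case: (S i j).
  by rewrite sum_nat_const card_ord.
have fin : (P \x P)%E A \is a fin_num.
  rewrite ge0_fin_numE; last exact: (@measure_ge0 _ _ _ (P \x P)%E).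
  by apply: le_lt_trans (@probability_le1 _ _ _ (P \x P)%E A mA) _; rewrite ltry.
have main (q : \bar R) d : q \is a fin_num ->
    ((1 - d)%:E <= 1%:E - q -> q <= d%:E)%E.
  by case: q => // q _; rewrite -EFinB !lee_fin; lra.
exact: main fin.
Qed.

End rectangle_bounds.

(** * Measurability of the correlation sets *)

Section measurability.
Context {R : realType}.
Local Notation RM := (measurableTypeR R).
Implicit Types (g h : RM -> RM).

Lemma measurable_iter g n : measurable_fun setT g -> measurable_fun setT (iter n g).
Proof.
move=> mg; elim: n => [|n IH]; first exact: measurable_id.
exact: (measurableT_comp mg IH).
Qed.

(** The set is a countable intersection over times. The map [h] is measurable on the whole line and
    agrees with [g] on [0, 1], which the orbits never leave. *)
Lemma measurable_corr_set (g h : RM -> RM) ell (r : R) : ell_ge1 ell ->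
  (forall x : R, 0 <= x <= 1 -> 0 <= g x <= 1) ->
  (forall x : R, 0 <= x <= 1 -> g x = h x) -> measurable_fun setT h ->
  measurable ([set xy | 0 <= xy.1 <= 1 /\ 0 <= xy.2 <= 1 /\
                 varrho g ell xy.1 xy.2 <= r] : set (RM * RM)).
Proof.
move=> ell1 g01 gh mh.
have it01 n x : 0 <= x <= 1 -> 0 <= iter n g x <= 1.
  by move=> hx; elim: n => //= n IH; exact: g01.
have ith n x : 0 <= x <= 1 -> iter n g x = iter n h x.
  by move=> hx; elim: n => //= n <-; rewrite gh ?it01.
pose D t : set (RM * RM) := [set xy | `|iter t h xy.1 - iter t h xy.2| <= r].
rewrite (_ : [set _ | _] = (`[0, 1]%classic `*` `[0, 1]%classic) `&`
    \bigcap_(t in [set t | lt_ell t ell]) D t); last first.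
  apply/seteqP; split => [[x y] /= [hx [hy]]|[x y] /= [[]]].
    rewrite (varrho_le r ell1 (fun t => it01 t x hx) (fun t => it01 t y hy)) => h1.
    split; first by rewrite !in_itv /= hx hy.
    by move=> t /= ht; rewrite /D /= -!ith//; exact: h1.
  rewrite !in_itv /= => hx hy hD; do 2 split => //.
  rewrite (varrho_le r ell1 (fun t => it01 t x hx) (fun t => it01 t y hy)) => t ht.
  by rewrite !ith//; exact: hD.
apply: measurableI; first by apply: measurableX; exact: measurable_itv.
apply: bigcap_measurableType => t _.
have mD : measurable_fun [set: RM * RM]
    (fun xy => `|iter t h xy.1 - iter t h xy.2|).
  apply: measurableT_comp => //; apply: measurable_funB.
    by apply: (measurableT_comp (measurable_iter t mh)); exact: measurable_fst.
  by apply: (measurableT_comp (measurable_iter t mh)); exact: measurable_snd.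
have := @measurable_fun_le _ _ R setT _ (cst r) measurableT mD (measurable_cst _).
by rewrite setTI.
Qed.

Variable al : R.
Hypothesis hal : 0 < al < 2^-1.

Definition falpha0 (x : RM) : RM := if 0 <= x < 1 then falpha al x else 0.

Lemma falpha0E (x : R) : 0 <= x <= 1 -> falpha al x = falpha0 x.
Proof.
move=> /andP[x0]; rewrite le_eqVlt /falpha0 => /orP[/eqP ->|x1].
  by rewrite ltxx andbF falpha1.
by rewrite x0 x1.
Qed.

Lemma measurable_affine (a b : R) (E : set RM) :
  measurable_fun E (fun x : RM => a * x + b : RM).
Proof.
by apply: measurable_funTS; apply: measurable_funD.
Qed.

Lemma measurable_falpha0 : measurable_fun setT falpha0.
Proof.
(* A countable partition of the line: the pieces of each level, with index 0 for everything outside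
   [0, 1). *)
pose E n : set RM := if n is n'.+1 then `[1 - al ^+ n', 1 - al ^+ n[%classic
  else ~` `[0, 1[%classic.
have ET : \bigcup_n E n = setT.
  apply/seteqP; split => // x _.
  have [x01|x01] := boolP (0 <= x < 1); last first.
    by exists 0%N => //=; rewrite in_itv /=; exact/negP.
  have [j hj] := level_ex hal x01.
  by exists j.+1 => //=; rewrite in_itv.
have mE n : measurable (E n).
  by case: n => [|n]; [apply: measurableC|]; exact: measurable_itv.
rewrite -ET; apply/measurable_fun_bigcup => // -[|n].
  apply: (eq_measurable_fun (cst 0 : RM -> RM)); last exact: measurable_cst.
  by move=> x; rewrite inE /= in_itv /= => /negP h; rewrite /falpha0 ifN.
pose a := 1 - al ^+ n + al ^+ n.+1.
pose s := (1 - al + al ^+ 2) / (2 * al - 1).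
apply: (eq_measurable_fun (fun x : RM =>
    if x <= a then 1 * x + (- 1 + 2 * al ^+ n - al ^+ n.+1)
    else s * x + (- s + al ^+ n.+2 * ((2 - al) / (2 * al - 1))))).
  move=> x; rewrite inE /= in_itv /= => /andP[xl xr].
  have x01 : 0 <= x < 1.
    by have := alX_le1 hal n; have := alX_gt0 hal n.+1; lra.
  rewrite /falpha0 x01; case: ifPn => xa.
    by rewrite (@falpha_left _ al x n.+1)//= ?xl//; lra.
  by rewrite (@falpha_right _ al x n.+1)//= -/s ?xr ?andbT ?ltNge//; lra.
apply: measurable_fun_if => //.
- by apply: measurable_fun_ler => //; exact: measurable_id.
- exact: measurable_affine.
- exact: measurable_affine.
Qed.

End measurability.

(** * Bracketing the correlation integral of [falpha] *)

Section correlation_integrals.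
Context {R : realType}.
Local Notation RM := (measurableTypeR R).
Variable al : R.
Hypothesis hal : 0 < al < 2^-1.
Implicit Types (ell : option nat) (r : R) (k : nat).

Lemma kappa_kap k i :
  kappa al [tuple odd (i %/ 2 ^ t) | t < k] = kap al k i.
Proof.
rewrite /kappa; under eq_bigr do rewrite tnth_mktuple.
elim: k i => [|k IH] i; first by rewrite big_ord0 mulr0.
rewrite big_ord_recl /= expn0 divn1 expr0 mulr1 mulrDr; congr (_ + _).
rewrite -IH mulrCA; congr (_ * _); rewrite mulr_sumr; apply: eq_bigr => t _.
by rewrite /bump /= add1n exprS expnS divnMA divn2; ring.
Qed.

(** Empty from [2 ^ k] on, so that the family indexed by all naturals is disjoint. *)
Definition cylinder k i : set RM :=
  if (i < 2 ^ k)%N then `[kap al k i, kap al k i + al ^+ k]%classic else set0.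

Lemma measurable_cylinder k i : measurable (cylinder k i).
Proof. by rewrite /cylinder; case: ifP => // _; exact: measurable_itv. Qed.

Lemma trivIset_cylinder k : trivIset setT (cylinder k).
Proof.
apply/trivIsetP => i j _ _ ij; rewrite /cylinder.
case: ifP => iM; last by rewrite set0I.
case: ifP => jM; last by rewrite setI0.
rewrite -subset0 => x [] /=; rewrite !in_itv /= => /andP[? ?] /andP[? ?].
have : al ^+ k < `|kap al k i - kap al k j|.
  by apply: kap_sep => //; rewrite !modn_small.
by rewrite ltNge => /negP; apply; rewrite ler_norml; apply/andP; split; lra.
Qed.

Lemma cylinderP k i x : (i < 2 ^ k)%N -> cylinder k i x ->
  exists2 z, 0 <= z <= 1 & x = kap al k i + al ^+ k * z.
Proof.
rewrite /cylinder => -> /=; rewrite in_itv /= => /andP[xl xr].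
have p0 := alX_gt0 hal k; exists ((x - kap al k i) / al ^+ k).
  by rewrite ler_pdivrMr// ler_pdivlMr// mul0r mul1r; apply/andP; split; lra.
by rewrite mulrCA divff ?gt_eqF// mulr1 addrC subrK.
Qed.

Lemma cylinder_dist k i j x y t : (i < 2 ^ k)%N -> (j < 2 ^ k)%N ->
  cylinder k i x -> cylinder k j y ->
  `|(iter t (falpha al) x - iter t (falpha al) y)
    - (kap al k (i + t) - kap al k (j + t))| <= al ^+ k.
Proof.
move=> iM jM /(cylinderP iM)[z hz ->] /(cylinderP jM)[w hw ->].
rewrite !iter_falpha_kap//.
have /andP[] := iter_falpha_01 hal ((i + t) %/ 2 ^ k) hz.
have /andP[] := iter_falpha_01 hal ((j + t) %/ 2 ^ k) hw.
move: (iter _ _ z) (iter _ _ w) => u v v0 v1 u0 u1.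
have p0 := alX_gt0 hal k.
rewrite [X in `|X|](_ : _ = al ^+ k * (u - v)); last by lra.
rewrite normrM (gtr0_norm p0) ger_pMr// ler_norml.
by apply/andP; split; lra.
Qed.

Lemma cylinder_01 k i x : (i < 2 ^ k)%N -> cylinder k i x -> 0 <= x <= 1.
Proof.
move=> iM; rewrite /cylinder iM /= in_itv /= => /andP[? ?].
by have := kap_ge0 hal k i; have := kap_le hal k i; lra.
Qed.

Lemma corr_int_bracket (mu : probability RM R) ell r k : ell_ge1 ell ->
  is_mu_alpha al mu ->
  model_corr al k ell (r - al ^+ k) <= corr_int (falpha al) mu ell r
    <= model_corr al k ell (r + al ^+ k).
Proof.
move=> ell1 [mu01 muI].
have PI i : (i < 2 ^ k)%N -> mu (cylinder k i) = ((2 ^ k)%N%:R^-1)%:E.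
  move=> iM; rewrite /cylinder iM natrX; case: k iM => [|k] iM.
    (* [is_mu_alpha] prescribes interval masses from length 1 on; at length 0 the cell is [0, 1]
       itself. *)
    transitivity (1%E : \bar R); last by congr EFin; exact/esym/invr1.
    by rewrite -mu01 /= add0r.
  by rewrite -(muI _ [tuple odd (i %/ 2 ^ t) | t < k.+1])// /Ialpha kappa_kap.
rewrite /corr_int; set A : set (RM * RM) := [set _ | _].
have mA : measurable A.
  apply: (measurable_corr_set _ ell1 (h := falpha0 al)).
  - by move=> x; exact: falpha_01.
  - by move=> x; exact: falpha0E.
  - exact: measurable_falpha0.
have fin : (mu \x mu)%E A \is a fin_num.
  rewrite ge0_fin_numE; last exact: (@measure_ge0 _ _ _ (mu \x mu)%E).
  by apply: le_lt_trans (@probability_le1 _ _ _ (mu \x mu)%E A mA) _; rewrite ltry.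
have tI := @trivIset_cylinder k; have mI := @measurable_cylinder k.
have AP i j x y : (i < 2 ^ k)%N -> (j < 2 ^ k)%N ->
    cylinder k i x -> cylinder k j y ->
    A (x, y) <-> forall t, lt_ell t ell ->
      `|iter t (falpha al) x - iter t (falpha al) y| <= r.
  move=> iM jM Ix Iy.
  have hx := cylinder_01 iM Ix; have hy := cylinder_01 jM Iy.
  rewrite /A /= hx hy (varrho_le _ ell1).
  - by split => [[_ []]|].
  - by move=> t; exact: iter_falpha_01.
  - by move=> t; exact: iter_falpha_01.
rewrite -!lee_fin fineK//; apply/andP; split.
  apply: (density_le_product (S := code_close al k ell (r - al ^+ k)) mI tI PI mA).
  move=> i j iM jM /asboolP h [x y] [/= Ix Iy].
  apply/(AP i j) => // t ht.
  have h1 := h t ht; have := cylinder_dist t iM jM Ix Iy.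
  set w := _ - kap _ _ _ in h1 *; set v := _ - iter _ _ _ => h2.
  rewrite (_ : v = (v - w) + w); last by ring.
  by apply: le_trans (ler_normD _ _) _; lra.
have M0 : (0 < 2 ^ k)%N by rewrite expn_gt0.
apply: (product_le_density mI tI PI mA M0 (S := code_close al k ell (r + al ^+ k))).
move=> i j iM jM x y Ix Iy /(AP i j x y iM jM Ix Iy) h; apply/asboolP => t ht.
have h1 := h t ht; have := cylinder_dist t iM jM Ix Iy.
set w := _ - kap _ _ _; set v := _ - iter _ _ _ in h1 * => h2.
rewrite (_ : w = v - (v - w)); last by ring.
by apply: le_trans (ler_normB _ _) _; rewrite lerD.
Qed.

End correlation_integrals.

(** * The periodic orbit of [falphak] and its uniform measure *)

Section periodic_measure.
Context {R : realType}.
Local Notation RM := (measurableTypeR R).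
Variable al : R.
Hypothesis hal : 0 < al < 2^-1.
Implicit Types (ell : option nat) (r x : R) (k : nat).

Ltac alra := have /andP[? ?] := hal; lra.

(** The code of all ones is the left end of the last branch, which sends it to 0. All other codes
    lie where the map is [falpha], and no carry overflows. *)
Lemma falphak_kap k n : falphak al k (kap al k n) = kap al k n.+1.
Proof.
case: k => [//|k]; rewrite /falphak.
have p0 := alX_gt0 hal k.
have p2 : al ^+ k.+1 < 2^-1 * al ^+ k.
  by rewrite exprS ltr_pM2r//; alra.
have p3 := alX_gt0 hal k.+1.
have [h|h] := boolP (2 ^ k.+1 %| n.+1)%N.
  rewrite (kap_pred _ h) (kap_dvd _ h) ifN; last by rewrite -ltNge /=; lra.
  by rewrite lexx; lra.
rewrite ifT; last by have := kap_le_pred hal h; rewrite /=; lra.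
have := falpha_kap hal k.+1 n (z := 0); rewrite (negbTE h) mulr0 !addr0.
by apply; rewrite lexx ler01.
Qed.

Lemma iter_falphak_kap k n t :
  iter t (falphak al k) (kap al k n) = kap al k (n + t).
Proof. by elim: t => [|t IH]; rewrite ?addn0// iterS IH falphak_kap addnS. Qed.

Lemma kap0 k : kap al k 0 = 0.
Proof. exact/kap_dvd/dvdn0. Qed.

Lemma orbit_falphak k : Defs.orbit (falphak al k) 0 = kap al k @` `I_(2 ^ k).
Proof.
rewrite -(kap0 k); apply/seteqP; split => _ [n hn <-].
  exists (n %% 2 ^ k)%N; first by rewrite /= ltn_mod expn_gt0.
  by rewrite iter_falphak_kap add0n; apply: kap_mod; rewrite modn_mod.
by exists n => //; rewrite iter_falphak_kap.
Qed.

Lemma falphak_01 k x : 0 <= x <= 1 -> 0 <= falphak al k x <= 1.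
Proof.
case: k => [//|k] hx; rewrite /falphak /=.
have p0 := alX_gt0 hal k; have p1 := alX_le1 hal k.
have p2 : al ^+ k.+1 < 2^-1 * al ^+ k.
  by rewrite exprS ltr_pM2r//; alra.
have p3 := alX_gt0 hal k.+1.
set a := 1 - _ + _; set b := 1 - al ^+ k.+1.
have ha : 0 <= a <= 1 by rewrite /a; lra.
case: ifPn => xa; first exact: falpha_01.
case: ifPn => bx; first by rewrite /b in bx; lra.
have -> : b - 1 + al ^+ k.+1 = 0 by rewrite /b; ring.
rewrite -!ltNge in xa bx.
have ab : 0 < b - a by rewrite subr_gt0; lra.
rewrite (_ : _ + _ = falpha al a * ((b - x) / (b - a))); last first.
  by field; rewrite gt_eqF.
have /andP[f0 f1] := falpha_01 hal ha.
have t01 : 0 <= (b - x) / (b - a) <= 1.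
  by rewrite ler_pdivrMr// ler_pdivlMr// mul0r mul1r; apply/andP; split; lra.
have /andP[t0 t1] := t01.
by rewrite mulr_ge0//= mulr_ile1.
Qed.

Lemma measurable_falphak k : exists2 h : RM -> RM,
  (forall x, 0 <= x <= 1 -> falphak al k x = h x) & measurable_fun setT h.
Proof.
case: k => [|k]; first by exists id => //; exact: measurable_id.
rewrite /falphak /=.
set a := 1 - _ + _; set b := 1 - al ^+ k.+1; set ya := falpha al a.
set yb := b - 1 + _.
pose s := (yb - ya) / (b - a).
exists (fun x : RM => if x <= a then falpha0 al x else
    if b <= x then 1 * x + (- 1 + al ^+ k.+1) else s * x + (ya - s * a) : RM).
  move=> x hx; case: ifP => _; first exact: falpha0E.
  case: ifP => _; first by rewrite mul1r addrA.
  by rewrite mulrCA mulrA mulrC -/s; rewrite /s; ring.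
apply: measurable_fun_ifT.
- by apply: measurable_fun_ler => //; exact: measurable_id.
- exact: measurable_falpha0.
- apply: measurable_fun_ifT.
  + by apply: measurable_fun_ler => //; exact: measurable_id.
  + exact: measurable_affine.
  + exact: measurable_affine.
Qed.

Lemma uniform_onE (O : set R) (A : set RM) : finite_set O ->
  uniform_on O A =
  ((#|` fset_set O|%:R^-1 * \sum_(x <- fset_set O) (x \in A)%:R)%R)%:E.
Proof.
move=> fO; rewrite /uniform_on /= /mscale /= /msum EFinM; congr (_ * _)%E.
rewrite (big_nth 0) big_mkord -sumEFin; apply: eq_bigr => i _.
exact: diracE.
Qed.

Lemma finite_orbit k : finite_set (Defs.orbit (falphak al k) 0).
Proof. by rewrite orbit_falphak; exact/finite_image/finite_II. Qed.

Lemma card_orbit k : #|` fset_set (Defs.orbit (falphak al k) 0)| = (2 ^ k)%N.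
Proof.
rewrite orbit_falphak; apply: card_fset_set; apply: inj_card_eq => i j.
rewrite !inE /= => iM jM /(kap_inj hal).
by rewrite !modn_small.
Qed.

Lemma mu_alphak_setT k : mu_alphak al k [set: R] = 1%E.
Proof.
rewrite /mu_alphak uniform_onE; last exact: finite_orbit.
rewrite big_seq (eq_bigr (fun=> 1)); last by move=> x _; rewrite in_setT.
by rewrite -big_seq big_const_seq count_predT iter_addr_0 card_orbit mulVf.
Qed.

Lemma mu_alphak_point k n : mu_alphak al k [set kap al k n] = ((2 ^ k)%N%:R^-1)%:E.
Proof.
rewrite /mu_alphak uniform_onE; last exact: finite_orbit.
rewrite card_orbit (bigD1_seq (kap al k n)) ?fset_uniq//=; last first.
  rewrite in_fset_set; last exact: finite_orbit.
  rewrite inE; exists n => //.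
  by rewrite -{1}(kap0 k) iter_falphak_kap.
have in1 y : (y \in [set kap al k n]) = (y == kap al k n).
  by apply/idP/eqP; rewrite inE.
by rewrite in1 eqxx big1 ?addr0 ?mulr1// => x /negbTE; rewrite in1 => ->.
Qed.

Definition point_cell k i : set RM :=
  if (i < 2 ^ k)%N then [set kap al k i] else set0.

(** With single points as cells there is no radius loss, so the lower and upper bounds coincide. *)
Lemma corr_int_mu_alphak k ell r : ell_ge1 ell ->
  corr_int (falphak al k) (mu_alphak al k) ell r = model_corr al k ell r.
Proof.
move=> ell1.
(* The rectangle bounds require a [probability]; total mass 1 supplies that structure on the same
   measure. *)
pose P : probability RM R := HB.pack_for (probability RM R)
  (Measure.sort (mu_alphak al k))
  (Measure_isProbability.Build _ _ _ (mu_alphak al k) (mu_alphak_setT k)).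
have -> : corr_int (falphak al k) (mu_alphak al k) ell r =
  corr_int (falphak al k) P ell r by [].
have mI i : measurable (point_cell k i).
  by rewrite /point_cell; case: ifP => // _; exact: measurable_set1.
have tI : trivIset setT (point_cell k).
  apply/trivIsetP => i j _ _ ij; rewrite /point_cell.
  case: ifP => iM; last by rewrite set0I.
  case: ifP => jM; last by rewrite setI0.
  rewrite -subset0 => x [/= ->] /(kap_inj hal); rewrite !modn_small// => /eqP.
  by rewrite (negbTE ij).
have PI i : (i < 2 ^ k)%N -> P (point_cell k i) = ((2 ^ k)%N%:R^-1)%:E.
  by move=> iM; rewrite /point_cell iM; exact: mu_alphak_point.
rewrite /corr_int; set A : set (RM * RM) := [set _ | _].
have mA : measurable A.
  have [h fh mh] := measurable_falphak k.
  apply: (measurable_corr_set _ ell1 (h := h)) => //.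
  by move=> x; exact: falphak_01.
have fin : (P \x P)%E A \is a fin_num.
  rewrite ge0_fin_numE; last exact: (@measure_ge0 _ _ _ (P \x P)%E).
  by apply: le_lt_trans (@probability_le1 _ _ _ (P \x P)%E A mA) _; rewrite ltry.
have AP i j : A (kap al k i, kap al k j) <-> code_close al k ell r i j.
  have h n : 0 <= kap al k n <= 1 by exact: kap_01.
  rewrite /A /= !h (varrho_le _ ell1); try by move=> t; rewrite iter_falphak_kap.
  split=> [[_ []] _ hi|/asboolP hi].
    by apply/asboolP => t ht; have := hi t ht; rewrite !iter_falphak_kap.
  by do 2 split => //; move=> t ht; rewrite !iter_falphak_kap; exact: hi.
have cellP i x : (i < 2 ^ k)%N -> point_cell k i x -> x = kap al k i.
  by rewrite /point_cell => ->.
have M0 : (0 < 2 ^ k)%N by rewrite expn_gt0.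
apply/eqP; rewrite eq_le -!lee_fin fineK//; apply/andP; split.
  apply: (product_le_density mI tI PI mA M0 (S := code_close al k ell r)).
  by move=> i j iM jM x y /(cellP _ _ iM) -> /(cellP _ _ jM) -> /AP.
apply: (density_le_product (S := code_close al k ell r) mI tI PI mA).
by move=> i j iM jM /AP h [x y] [/= /(cellP _ _ iM) -> /(cellP _ _ jM) ->].
Qed.

End periodic_measure.

(** * Limits along a given orbit *)

Section orbit_limits.
Context {R : realType}.
Variables (al r x : R).
Hypotheses (hal : 0 < al < 2^-1) (r0 : 0 < r) (hx : 0 <= x <= 1).

Local Notation f := (falpha al).

Lemma falpha_determinism_cvg (c : option nat -> R) :
  (forall ell, ell_ge1 ell ->
     (fun n => corr_sum f ell x n r) @ \oo --> c ell) ->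
  0 < c (Some 1%N) -> forall ell, ell_ge1 ell ->
  (fun n => determinism f ell x n r) @ \oo --> det_of c ell.
Proof.
by move=> hc c0 ell; apply: determinism_cvg hc c0 ell => n; exact: iter_falpha_01.
Qed.

Lemma fixpt_det_cvg k ell : ell_ge1 ell -> reaches_code al k x (fixpt al) ->
  (fun n => determinism f ell x n r) @ \oo -->
    det_of (fun ell => model_corr al k ell r) ell.
Proof.
move=> ell1 xk; apply: falpha_determinism_cvg => //.
  by move=> l l1; exact: fixpt_corr_cvg.
by apply: model_corr_gt0; exact: ltW.
Qed.

Hypothesis codes : forall k, exists2 z, 0 <= z <= 1 & reaches_code al k x z.

Lemma code_corr_cvg ell c : ell_ge1 ell ->
  (forall k, model_corr al k ell (r - al ^+ k) <= c
               <= model_corr al k ell (r + al ^+ k)) ->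
  (fun n => corr_sum f ell x n r) @ \oo --> c.
Proof.
move=> ell1; apply: squeezed_cvg (code_corr_squeezed hal r hx ell1 codes) _.
exact: model_corr_tight.
Qed.

Lemma code_det_cvg (c : option nat -> R) :
  (forall ell k, ell_ge1 ell -> model_corr al k ell (r - al ^+ k) <= c ell
               <= model_corr al k ell (r + al ^+ k)) ->
  forall ell, ell_ge1 ell ->
  (fun n => determinism f ell x n r) @ \oo --> det_of c ell.
Proof.
move=> hc ell ell1; apply: falpha_determinism_cvg => //.
  by move=> l l1; apply: code_corr_cvg => // k; exact: hc.
by apply: (bracket_gt0 hal r0) => k; exact: hc.
Qed.

(** Convergence is claimed with no measure at hand, so the limit values are drawn from the brackets
    alone. *)
Lemma code_corr_ex : exists c : option nat -> R,
  forall ell k, ell_ge1 ell -> model_corr al k ell (r - al ^+ k) <= c ell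
               <= model_corr al k ell (r + al ^+ k).
Proof.
have ex ell : exists c : R, ell_ge1 ell ->
    forall k, model_corr al k ell (r - al ^+ k) <= c
               <= model_corr al k ell (r + al ^+ k).
  have [ell1|] := boolP (ell_ge1 ell); last by exists 0.
  have [|c hc _] := squeezed_cvg_ex (code_corr_squeezed hal r hx ell1 codes).
    exact: model_corr_tight.
  by exists c.
by have [c hc] := choice ex; exists c => ell k /hc.
Qed.

End orbit_limits.

Theorem theorem25 (R : realType) (alpha r : R)
    (halpha : 0 < alpha < 2^-1) (hr : 0 < r <= 1) :
  let f := falpha alpha in
  let fk := falphak alpha in
  (forall (x : R) (ell : option nat), 0 <= x <= 1 -> ell_ge1 ell ->
     cvgn (fun n => corr_sum f ell x n r) /\
     cvgn (fun n => determinism f ell x n r)) /\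
  (forall mu : probability (measurableTypeR R) R, is_mu_alpha alpha mu ->
   forall (x : R) (ell : option nat), 0 <= x <= 1 -> ell_ge1 ell ->
     ~ eventually_periodic f x ->
     corr_lim f ell x r = corr_int f mu ell r /\
     det_lim f ell x r = det_int f mu ell r) /\
  (forall (k : nat) (x : R) (ell : option nat), 0 <= x <= 1 -> ell_ge1 ell ->
     eventually_periodic_of_period f x (2 ^ k) ->
     corr_lim f ell x r = corr_int (fk k) (mu_alphak alpha k) ell r /\
     det_lim f ell x r = det_int (fk k) (mu_alphak alpha k) ell r).
Proof.
move=> f fk; have r0 : 0 < r by case/andP: hr.
split; last split.
- move=> x ell hx ell1.
  have [[k xk]|codes] := orbit_dichotomy halpha hx.
    split; apply/cvg_ex.
      by eexists; exact: fixpt_corr_cvg xk.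
    by eexists; exact: fixpt_det_cvg xk.
  have [c hc] := code_corr_ex r halpha hx codes.
  split; apply/cvg_ex.
    by exists (c ell); apply: code_corr_cvg => // k; exact: hc.
  by exists (det_of c ell); exact: code_det_cvg.
- move=> mu hmu x ell hx ell1 np.
  have codes := aperiodic_reaches_code halpha hx np.
  (* The integral lies in the same shrinking brackets as the correlation sums, which forces it to be
     their limit. *)
  have hc l k : ell_ge1 l -> _ := fun l1 => corr_int_bracket halpha r k l1 hmu.
  split; apply/cvg_lim => //.
    by apply: code_corr_cvg => // k; exact: hc.
  have -> : det_int f mu ell r = det_of (fun l => corr_int f mu l r) ell.
    by rewrite /det_int /det_of; case: ell {ell1}.
  exact: (@code_det_cvg _ _ _ _ halpha r0 hx codes (fun l => corr_int f mu l r)).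
- move=> k x ell hx ell1 /(period_reaches_fixpt halpha hx) xk.
  split; apply/cvg_lim => //.
    by rewrite corr_int_mu_alphak//; exact: fixpt_corr_cvg.
  have -> : det_int (fk k) (mu_alphak alpha k) ell r =
      det_of (fun ell => model_corr alpha k ell r) ell.
    rewrite /det_int /det_of; case: ell ell1 => [l|] l1;
      by rewrite !corr_int_mu_alphak.
  exact: fixpt_det_cvg.
Qed.
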